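(* Suppose $F(t,z)\not\equiv0$ is an entire function on $\mathbb{C}^2$ satisfying the heat equation $\partial_tF=\partial_z^2F$. If $$F(t^{\ast},z^{\ast})=\partial_zF(t^{\ast},z^{\ast})=0\qquad\text{for some }(t^{\ast},z^{\ast})\in\mathbb{C}^2,$$ then there is an open neighborhood $U\subset\mathbb{C}^2$ of $(t^{\ast},z^{\ast})$ such that $$|F(t,z)|+|\partial_zF(t,z)|>0\qquad\text{for every }(t,z)\in U\setminus\{(t^{\ast},z^{\ast})\}.$$
   Context: Here $t$ and $z$ are complex variables. *)

(* Defs.v *)
From Stdlib Require Import Reals.
From Coquelicot Require Import Coquelicot.

(* Points of C^2 are pairs (t, z).  Stating the scalar ring explicitly makes the
   Frechet differential below C-linear, so this is complex differentiability in
   both variables jointly, at every point. *)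
Definition entire2 (F : C * C -> C) : Prop :=
  forall p : C * C, ex_filterdiff (K := C_AbsRing) F (locally p).

(* [C_derive] is a total operator, meaningful where the complex derivative
   exists; for an entire [F] it exists everywhere. *)
Definition partial_z (F : C * C -> C) (p : C * C) : C :=
  C_derive (fun w : C => F (fst p, w)) (snd p).

(* As usual for a classical solution, the derivatives in the equation are
   required to exist and not just to agree as values of a total operator. *)
Definition heat_equation (F : C * C -> C) : Prop :=
  forall t z : C, exists d : C,
    is_derive (K := C_AbsRing) (fun s : C => F (s, z)) t d /\
    is_derive (K := C_AbsRing) (fun w : C => partial_z F (t, w)) z d.

(* Main.v *)
Require Import Defs.
From Stdlib Require Import Reals.
From Coquelicot Require Import Coquelicot.
From Stdlib Require Import Factorial Wf_nat Lra Lia.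
Local Open Scope R_scope.

(** Write [u_k] for the [k]-th derivative of [F] in [z].  The heat equation turns
    derivatives in [t] into derivatives in [z]: [d/dz u_k = u_(k+1)] and
    [d/dt u_k = u_(k+2)].  Such a family is called a heat chain below, and once it is
    known to exist and to be jointly continuous ([heat_chain_of_solution]) the
    argument only uses these two rules and the mean value inequality.

    Some [u_n (t0, z0)] is nonzero.  Otherwise the one-variable identity theorem
    ([derivative_chain_zero]) in [z] shows that every [u_k] vanishes on the line
    [t = t0]; then [F (., z)] has all its derivatives equal to zero at [t0], and the
    same theorem in [t] gives [F = 0].

    Let [n] be the least such index and give [t] weight 2 and [z] weight 1: look at
    the points with [|t - t0| <= rho^2] and [|z - z0| <= rho].  On them
    [u_k = O(rho^(n-k))] ([parabolic_O_vanishing]).  To leading order [F] is a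
    multiple of the [n]-th heat polynomial, which is quasi-homogeneous of degree [n].
    Instead of introducing this polynomial, consider the defect in Euler's relation,
    [L_k = (z-z0) u_(k+1) + 2 (t-t0) u_(k+2) - (n-k) u_k].  The [L_k] are again a heat
    chain, and they vanish at the base point for every [k <= n], so that
    [L_k = O(rho^(n+1-k))], one order better than the three terms.  Read as a
    recurrence between [u_k], [u_(k+1)] and [u_(k+2)], Euler's relation excludes a common
    zero of [u_0] and [u_1] at scale [rho] when [rho] is small:
    - if [|t-t0| >= d rho^2], solve it for [u_(k+2)]: starting from [u_0 = u_1 = 0] it
      propagates upwards the bound [u_k = O(rho^(n+1-k))], until [u_n = O(rho)]
      contradicts [u_n (t0, z0) <> 0] ([upper_bound_large_time]);
    - if [|t-t0| <= d rho^2] and [|z-z0| = rho] with [d] small, the term in [t-t0] is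
      negligible; solve for [u_k]: starting from [u_n <> 0] it propagates downwards
      the bound [|u_k| >= c rho^(n-k)], so that [u_0 <> 0]
      ([lower_bound_small_time]).

    The function theory needed is light.  The heat equation makes [F_z] differentiable
    in [z], hence continuous, so Goursat's argument can be avoided: for a
    holomorphic [f] with continuous derivative, the integrals of
    [f (z + r e^(ix)) e^(-ikx)] over a circle centred at [z] can be differentiated in
    [z] under the integral sign, and integration by parts in [x] shows that, suitably
    normalised, each one is the derivative of the previous one
    ([cauchy_derivative_chain]).  This gives derivatives of all orders together with
    Cauchy's estimates, without power series. *)

Notation is_derive_C f z d := (is_derive (K := C_AbsRing) (V := C_NormedModule) f z d).
Notation is_derive_RC h x d := (is_derive (K := R_AbsRing) (V := C_R_NormedModule) h x d).
Notation CInt g a b := (RInt (V := C_R_CompleteNormedModule) g a b).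

(** * Derivatives over the complex numbers and along real paths *)

(** The neighbourhoods of [C] as a scalar field are discs and those of [C] as a product
    are squares; stating differentiability with [Cmod] hides this difference. *)
Lemma is_derive_C_eps (f : C -> C) (z d : C) :
  is_derive_C f z d <->
  forall eps, 0 < eps -> exists delta, 0 < delta /\ forall w, Cmod (w - z) < delta ->
    Cmod (f w - f z - (w - z) * d)%C <= eps * Cmod (w - z).
Proof.
split.
- intros [_ H] eps Heps.
  destruct (H z (fun P HP => HP) (mkposreal eps Heps)) as [delta Hd].
  exists delta; split; [apply cond_pos|].
  intros w Hw. exact (Hd w Hw).
- intros H; split; [apply is_linear_scal_l|].
  intros x Hx.
  assert (Ex : z = x)
    by exact (is_filter_lim_locally_unique (V := AbsRing_NormedModule C_AbsRing) z x Hx).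
  subst x.
  intros eps; destruct (H eps (cond_pos eps)) as [delta [Hd0 Hd]].
  exists (mkposreal delta Hd0); intros w Hw; exact (Hd w Hw).
Qed.

Lemma is_derive_RC_eps (h : R -> C) (s : R) (d : C) :
  is_derive_RC h s d <->
  forall eps, 0 < eps -> exists delta, 0 < delta /\ forall x, Rabs (x - s) < delta ->
    Cmod (h x - h s - RtoC (x - s) * d)%C <= eps * Rabs (x - s).
Proof.
assert (E : forall x, @norm R_AbsRing C_R_NormedModule
   (minus (minus (h x) (h s)) (scal (minus x s) d)) = Cmod (h x - h s - RtoC (x - s) * d)%C).
{ intros x. rewrite <- Cmod_norm. f_equal.
  unfold minus, scal; simpl. unfold prod_scal, scal; simpl. unfold mult; simpl.
  unfold plus, opp; simpl; unfold Cminus, Cmult, RtoC, Cplus, Copp; simpl.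
  apply injective_projections; simpl; unfold plus, opp; simpl; ring. }
split.
- intros [_ H] eps Heps.
  destruct (H s (fun P HP => HP) (mkposreal eps Heps)) as [delta Hd].
  exists delta; split; [apply cond_pos|].
  intros w Hw. rewrite <- E. exact (Hd w Hw).
- intros H; split; [apply is_linear_scal_l|].
  intros x Hx.
  assert (Ex : s = x)
    by exact (is_filter_lim_locally_unique (V := R_NormedModule) s x Hx).
  subst x.
  intros eps; destruct (H eps (cond_pos eps)) as [delta [Hd0 Hd]].
  exists (mkposreal delta Hd0); intros w Hw.
  exact (Rle_trans _ _ _ (Req_le _ _ (E w)) (Hd w Hw)).
Qed.

(** The general chain rule keeps the field of scalars fixed; here a derivative over [C]
    meets one over [R]. *)
Lemma is_derive_comp_RC (f : C -> C) (h : R -> C) (s : R) (v d : C) :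
  is_derive_C f (h s) d ->
  is_derive_RC h s v ->
  is_derive_RC (fun x => f (h x)) s (v * d)%C.
Proof.
rewrite is_derive_C_eps, !is_derive_RC_eps. intros Hf Hh eps Heps.
pose (B := Cmod v + 1).
assert (HB : 0 < B) by (generalize (Cmod_ge_0 v); unfold B; lra).
pose (Q := Cmod d + 1).
assert (HQ : 0 < Q) by (generalize (Cmod_ge_0 d); unfold Q; lra).
destruct (Hf (eps / (2 * B))) as [d1 [Hd1 H1]].
{ apply Rdiv_lt_0_compat; lra. }
destruct (Hh (Rmin 1 (eps / (2 * Q)))) as [d2 [Hd2 H2]].
{ apply Rmin_pos; [lra|]. apply Rdiv_lt_0_compat; lra. }
exists (Rmin d2 (d1 / B)); split.
{ apply Rmin_pos; [lra|]. apply Rdiv_lt_0_compat; lra. }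
intros x Hx.
assert (Hx2 := Rlt_le_trans _ _ _ Hx (Rmin_l _ _)).
assert (Hx1 := Rlt_le_trans _ _ _ Hx (Rmin_r _ _)).
specialize (H2 x Hx2).
assert (Hinc : Cmod (h x - h s) <= B * Rabs (x - s)).
{ replace (h x - h s)%C with ((h x - h s - RtoC (x - s) * v) + RtoC (x - s) * v)%C by ring.
  eapply Rle_trans; [apply Cmod_triangle|]. rewrite Cmod_mult, Cmod_R.
  generalize (Rabs_pos (x - s)) (Rmin_l 1 (eps / (2 * Q))); unfold B; nra. }
assert (Hxs : B * Rabs (x - s) < d1).
{ apply (Rmult_lt_compat_l B) in Hx1; [|lra]. replace (B * (d1 / B)) with d1 in Hx1 by (field; lra). lra. }
specialize (H1 (h x) (Rle_lt_trans _ _ _ Hinc Hxs)).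
replace (f (h x) - f (h s) - RtoC (x - s) * (v * d))%C with
 ((f (h x) - f (h s) - (h x - h s) * d) + (h x - h s - RtoC (x - s) * v) * d)%C by ring.
eapply Rle_trans; [apply Cmod_triangle|]. rewrite Cmod_mult.
assert (P0 := Rabs_pos (x - s)). assert (Pd := Cmod_ge_0 d).
assert (A1 : Cmod (f (h x) - f (h s) - (h x - h s) * d) <= eps / 2 * Rabs (x - s)).
{ eapply Rle_trans; [apply H1|].
  eapply Rle_trans; [apply Rmult_le_compat_l; [|apply Hinc]|].
  apply Rlt_le, Rdiv_lt_0_compat; lra. right; field; lra. }
assert (A2 : Cmod (h x - h s - RtoC (x - s) * v) * Cmod d <= eps / 2 * Rabs (x - s)).
{ apply Rle_trans with ((eps / (2 * Q) * Rabs (x - s)) * Q).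
  apply Rmult_le_compat; try apply Cmod_ge_0; [|unfold Q; lra].
  eapply Rle_trans; [apply H2|]. apply Rmult_le_compat_r; [lra|apply Rmin_r].
  right; field; lra. }
lra.
Qed.

Lemma is_derive_Re_mult (c : C) (h : R -> C) (s : R) (v : C) :
  is_derive_RC h s v ->
  is_derive (fun x => Re (c * h x)) s (Re (c * v)).
Proof.
intros H.
assert (L : is_linear (U := C_R_NormedModule) (V := R_NormedModule) (fun w : C => Re (c * w))).
{ apply Build_is_linear.
  - intros x y. unfold plus; simpl. unfold Re; simpl. unfold plus; simpl. ring.
  - intros k x. unfold scal; simpl. unfold mult; simpl. unfold scal; simpl; unfold mult; simpl. ring.
  - exists (Cmod c + 1); split; [generalize (Cmod_ge_0 c); lra|].
    intros x. rewrite <- Cmod_norm.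
    eapply Rle_trans; [apply re_le_Cmod|]. rewrite Cmod_mult.
    generalize (Cmod_ge_0 x); nra. }
eapply filterdiff_ext_lin.
- apply (filterdiff_comp (V := C_R_NormedModule) (W := R_NormedModule) h (fun w => Re (c * w)) _ _ H (filterdiff_linear _ L)).
- intros y. apply (linear_scal _ L y v).
Qed.

(** A complex-valued mean value inequality that keeps the factor [1 / (N + 1)] of
    the integral of [x ^ N]; iterating it produces the factorials in Taylor's estimate.
    It reduces to the real case by projecting [h] onto the direction of [h s - h 0]. *)
Lemma path_growth (h dh : R -> C) (B : R) (N : nat) (s : R) :
  0 <= s ->
  (forall x, 0 <= x <= s -> is_derive_RC h x (dh x)) ->
  (forall x, 0 <= x <= s -> Cmod (dh x) <= B * x ^ N) ->
  Cmod (h s - h 0) <= B * s ^ S N / INR (S N).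
Proof.
intros Hs Hd HB.
assert (HN : 0 < INR (S N)) by apply lt_0_INR, Nat.lt_0_succ.
set (u := (h s - h 0)%C).
(* [psi] is nonincreasing, and its increment over [0, s] is
   [|u|^2 - |u| B s^(N+1) / (N+1)]. *)
set (psi := fun x => Re (Cconj u * h x) - Cmod u * (B * x ^ S N / INR (S N))).
assert (Hpsi : forall x, 0 <= x <= s ->
  is_derive psi x (Re (Cconj u * dh x) - Cmod u * (B * x ^ N))).
{ intros x Hx.
  apply (is_derive_minus (K := R_AbsRing) (V := R_NormedModule)).
  - apply is_derive_Re_mult, Hd, Hx.
  - auto_derive; [trivial|]. change (Nat.pred (S N)) with N.
    change (match N with O => 1 | S _ => INR N + 1 end) with (INR (S N)). field. apply Rgt_not_eq, HN. }
destruct (MVT_gen psi 0 s (fun x => Re (Cconj u * dh x) - Cmod u * (B * x ^ N))) as [x [Hx E]].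
- intros x Hx. apply Hpsi. rewrite Rmin_left, Rmax_right in Hx; lra.
- intros x Hx. apply derivable_continuous_pt. eexists. apply is_derive_Reals, Hpsi.
  rewrite Rmin_left, Rmax_right in Hx; lra.
- rewrite Rmin_left, Rmax_right in Hx by lra.
  assert (F : Re (Cconj u * dh x) <= Cmod u * (B * x ^ N)).
  { eapply Rle_trans; [apply Rle_abs|]. eapply Rle_trans; [apply re_le_Cmod|].
    rewrite Cmod_mult, Cmod_conj. apply Rmult_le_compat_l; [apply Cmod_ge_0|]. auto. }
  assert (G : psi s - psi 0 = Cmod u ^ 2 - Cmod u * (B * s ^ S N / INR (S N))).
  { unfold psi. rewrite pow_i by lia.
    replace (Cmod u ^ 2) with (Re (Cconj u * h s) - Re (Cconj u * h 0)).
    - unfold Rdiv; ring.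
    - rewrite Cmod2_alt. unfold u, Re, Im; simpl. ring. }
  assert (Hu := Cmod_ge_0 u).
  destruct (Rle_lt_or_eq_dec _ _ Hu) as [Hu'|Hu'].
  + apply Rmult_le_reg_l with (Cmod u); [trivial|].
    assert (psi s - psi 0 <= 0) by (rewrite E; nra). nra.
  + rewrite <- Hu'.
    assert (0 <= B * s ^ S N); [|apply Rmult_le_pos; [trivial|apply Rlt_le, Rinv_0_lt_compat; trivial]].
    specialize (HB s (conj Hs (Rle_refl s))).
    generalize (Cmod_ge_0 (dh s)). simpl. nra.
Qed.

Lemma is_derive_segment (a b : C) (x : R) :
  is_derive_RC (fun x => a + RtoC x * b)%C x b.
Proof.
apply is_derive_RC_eps; intros eps Heps; exists 1; split; [lra|]; intros y _.
rewrite RtoC_minus.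
match goal with |- Cmod ?A <= _ => replace A with (RtoC 0) by ring end.
rewrite Cmod_0. generalize (Rabs_pos (y - x)); nra.
Qed.

Lemma segment_growth (f df : C -> C) (a b : C) (B : R) :
  (forall x, 0 <= x <= 1 -> let w := (a + RtoC x * (b - a))%C in
     is_derive_C f w (df w) /\ Cmod (df w) <= B) ->
  Cmod (f b - f a) <= B * Cmod (b - a).
Proof.
intros H.
assert (G := path_growth (fun x => f (a + RtoC x * (b - a)))%C
  (fun x => (b - a) * df (a + RtoC x * (b - a)))%C (B * Cmod (b - a)) 0 1 Rle_0_1).
cbv beta in G.
replace (a + RtoC 1 * (b - a))%C with b in G by ring.
replace (a + RtoC 0 * (b - a))%C with a in G by ring.
replace (B * Cmod (b - a) * 1 ^ 1 / INR 1) with (B * Cmod (b - a)) in G by (simpl; field).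
apply G; intros x Hx; destruct (H x Hx) as [H1 H2].
- apply (is_derive_comp_RC f (fun x => a + RtoC x * (b - a))%C); [exact H1|].
  apply is_derive_segment.
- rewrite Cmod_mult. simpl. generalize (Cmod_ge_0 (b - a)); nra.
Qed.

Lemma is_derive_RC_pair (f g : R -> R) (x a b : R) :
  is_derive f x a -> is_derive g x b -> is_derive_RC (fun y => (f y, g y)) x (a, b).
Proof.
intros Hf Hg.
apply (filterdiff_comp'_2 (U := R_NormedModule) (V := R_NormedModule) (W := C_R_NormedModule)
  f g (fun u v => (u, v)) x _ _ (fun u v => (u, v)) Hf Hg).
apply filterdiff_linear, is_linear_prod; [apply is_linear_fst|apply is_linear_snd].
Qed.

Lemma is_derive_RC_fst (h : R -> C) (x : R) (d : C) :
  is_derive_RC h x d -> is_derive (fun y => fst (h y)) x (fst d).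
Proof.
intros H.
exact (filterdiff_comp (V := C_R_NormedModule) (W := R_NormedModule) h fst _ _ H
  (filterdiff_linear _ (is_linear_fst (U := R_NormedModule) (V := R_NormedModule)))).
Qed.

Lemma is_derive_RC_snd (h : R -> C) (x : R) (d : C) :
  is_derive_RC h x d -> is_derive (fun y => snd (h y)) x (snd d).
Proof.
intros H.
exact (filterdiff_comp (V := C_R_NormedModule) (W := R_NormedModule) h snd _ _ H
  (filterdiff_linear _ (is_linear_snd (U := R_NormedModule) (V := R_NormedModule)))).
Qed.

Lemma is_derive_RC_mult (f g : R -> C) (x : R) (a b : C) :
  is_derive_RC f x a -> is_derive_RC g x b ->
  is_derive_RC (fun y => f y * g y)%C x (a * g x + f x * b)%C.
Proof.
intros Hf Hg.
assert (f1 := is_derive_RC_fst _ _ _ Hf). assert (f2 := is_derive_RC_snd _ _ _ Hf).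
assert (g1 := is_derive_RC_fst _ _ _ Hg). assert (g2 := is_derive_RC_snd _ _ _ Hg).
replace (a * g x + f x * b)%C with
  ((fst a * fst (g x) + fst (f x) * fst b) - (snd a * snd (g x) + snd (f x) * snd b),
   (fst a * snd (g x) + fst (f x) * snd b) + (snd a * fst (g x) + snd (f x) * fst b)).
- apply is_derive_RC_pair.
  + apply (is_derive_minus (V := R_NormedModule)); apply (is_derive_mult (K := R_AbsRing)); trivial; intros; apply Rmult_comm.
  + apply (is_derive_plus (V := R_NormedModule)); apply (is_derive_mult (K := R_AbsRing)); trivial; intros; apply Rmult_comm.
- apply injective_projections; simpl; ring.
Qed.

Lemma continuous_is_derive_RC (h : R -> C) (x : R) (d : C) : is_derive_RC h x d -> continuous h x.
Proof. intros H. apply (ex_derive_continuous (K := R_AbsRing) (V := C_R_NormedModule)). exists d; exact H. Qed.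

Lemma continuous_is_derive_C (f : C -> C) (z d : C) : is_derive_C f z d -> continuous f z.
Proof. intros H P HP. apply locally_C.
 apply (ex_derive_continuous (K := C_AbsRing) (V := C_NormedModule) f z); [exists d; exact H|exact HP].
Qed.

Lemma is_derive_C_scal (f : C -> C) (c z d : C) :
  is_derive_C f z d -> is_derive_C (fun w => c * f w)%C z (c * d)%C.
Proof.
intros H.
eapply filterdiff_ext_lin.
- apply (filterdiff_comp (U := AbsRing_NormedModule C_AbsRing) (V := C_NormedModule) (W := C_NormedModule)
    f (fun w => c * w)%C _ (fun w => c * w)%C H).
  apply filterdiff_linear. apply (is_linear_scal_r (K := C_AbsRing) (V := C_NormedModule) c Cmult_comm).
- intros y. change (c * (y * d) = y * (c * d))%C. ring.
Qed.

(** [C] as a scalar field and [C] as a normed module carry different uniform structures,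
    so the product rule for scalar functions does not apply directly; the Euler operator
    only involves factors of the form [w - a]. *)
Lemma is_derive_C_mult_id (g : C -> C) (a z d : C) :
  is_derive_C g z d -> is_derive_C (fun w => (w - a) * g w)%C z (g z + (z - a) * d)%C.
Proof.
intros Hg.
assert (H1 : filterdiff (K := C_AbsRing) (U := AbsRing_NormedModule C_AbsRing) (V := AbsRing_NormedModule C_AbsRing)
  (fun w : C => w - a)%C (locally (T := AbsRing_UniformSpace C_AbsRing) z) (fun y => y)).
{ eapply filterdiff_ext_lin.
  - apply (filterdiff_minus_fct (U := AbsRing_NormedModule C_AbsRing) (V := AbsRing_NormedModule C_AbsRing)
      (fun w : C => w) (fun _ => a)).
    + apply (filterdiff_id (V := AbsRing_NormedModule C_AbsRing)).
    + apply (filterdiff_const (V := AbsRing_NormedModule C_AbsRing)).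
  - intros y. apply (minus_zero_r (G := C_AbelianGroup)). }
eapply filterdiff_ext_lin.
- apply (filterdiff_scal_fct (U := AbsRing_NormedModule C_AbsRing) (V := C_NormedModule) z
    (fun w => w - a)%C g _ _ Cmult_comm H1 Hg).
- intros y. change (y * g z + (z - a) * (y * d) = y * (g z + (z - a) * d))%C. ring.
Qed.

Lemma is_derive_C_plus (f g : C -> C) (z a b : C) :
  is_derive_C f z a -> is_derive_C g z b -> is_derive_C (fun w => f w + g w)%C z (a + b)%C.
Proof. apply (is_derive_plus (K := C_AbsRing) (V := C_NormedModule)). Qed.

Lemma is_derive_C_minus (f g : C -> C) (z a b : C) :
  is_derive_C f z a -> is_derive_C g z b -> is_derive_C (fun w => f w - g w)%C z (a - b)%C.
Proof. apply (is_derive_minus (K := C_AbsRing) (V := C_NormedModule)). Qed.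

Lemma is_derive_C_affine (f : C -> C) (a b z d : C) :
  is_derive_C f (a + z * b)%C d -> is_derive_C (fun w => f (a + w * b))%C z (b * d)%C.
Proof.
intros H.
apply (is_derive_comp (K := C_AbsRing) (V := C_NormedModule) f (fun w => a + w * b)%C); [exact H|].
cut (is_derive (K := C_AbsRing) (V := AbsRing_NormedModule C_AbsRing) (fun w => a + w * b)%C z (RtoC 0 + b)%C).
{ now rewrite Cplus_0_l. }
apply (is_derive_plus (K := C_AbsRing) (V := AbsRing_NormedModule C_AbsRing) (fun _ => a) (fun w => w * b)%C).
- apply (is_derive_const (K := C_AbsRing) (V := AbsRing_NormedModule C_AbsRing)).
- apply filterdiff_linear, (is_linear_scal_l (K := C_AbsRing) (V := AbsRing_NormedModule C_AbsRing)).
Qed.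

Lemma is_derive_C_unique (f : C -> C) (z a b : C) :
  is_derive_C f z a -> is_derive_C f z b -> a = b.
Proof.
intros Ha Hb. rewrite <- (is_C_derive_unique f z a Ha). exact (is_C_derive_unique f z b Hb).
Qed.

(** * Continuity and differentiation of integrals with a parameter *)

(** Compactness of a segment as an induction principle: a property of sets that is
    inherited by subsets and finite unions, and holds locally, holds for the segment.
    The supremum of the initial segments that satisfy [P] can only be [b]. *)
Lemma interval_cover (P : (R -> Prop) -> Prop) (a b : R) :
  a <= b ->
  (forall A B : R -> Prop, (forall x, B x -> A x) -> P A -> P B) ->
  (forall A B, P A -> P B -> P (fun x => A x \/ B x)) ->
  (forall x, a <= x <= b -> exists d, 0 < d /\ P (fun y => Rabs (y - x) < d)) ->
  P (fun x => a <= x <= b).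
Proof.
intros Hab Hsub Hun Hloc.
pose (E := fun x => a <= x <= b /\ P (fun y => a <= y <= x)).
destruct (completeness E) as [c [Hub Hlub]].
- exists b. intros x [Hx _]; lra.
- exists a. split; [lra|]. destruct (Hloc a) as [d [Hd HP]]; [lra|].
  apply Hsub with (2 := HP). intros x Hx. rewrite Rabs_pos_eq; lra.
- assert (Hc : a <= c <= b).
  { split.
    - apply Hub. split; [lra|]. destruct (Hloc a) as [d [Hd HP]]; [lra|].
      apply Hsub with (2 := HP). intros x Hx. rewrite Rabs_pos_eq; lra.
    - apply Hlub. intros x [Hx _]; lra. }
  destruct (Hloc c Hc) as [d [Hd HP]].
  assert (Hx : exists x, E x /\ c - d < x).
  { apply Classical_Prop.NNPP. intros N.
    assert (c <= c - d); [|lra]. apply Hlub. intros x Hx.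
    apply Rnot_lt_le. intros L. apply N. exists x; split; trivial. }
  destruct Hx as [x [[Hx HPx] Hxc]].
  assert (HE : E (Rmin b (c + d / 2))).
  { split.
    - split; [apply Rmin_glb; lra|apply Rmin_l].
    - apply Hsub with (2 := Hun _ _ HPx HP). intros y [Hy1 Hy2].
      generalize (Rmin_r b (c + d / 2)); intros Hm.
      destruct (Rle_dec y x) as [L|L]; [left; lra|right; apply Rabs_lt_between; lra]. }
  assert (Hb := Hub _ HE).
  destruct HE as [_ HE]. revert Hb HE. unfold Rmin.
  destruct (Rle_dec b (c + d / 2)); [trivial|lra].
Qed.

Lemma continuous_C_eps {U : UniformSpace} (f : U -> C) (x : U) :
  continuous f x <->
  forall eps, 0 < eps -> locally x (fun y => Cmod (f y - f x) < eps).
Proof.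
split.
- intros H eps Heps.
  exact (proj1 (filterlim_locally_ball_norm (K := C_AbsRing) (U := C_NormedModule) f (f x)) H (mkposreal eps Heps)).
- intros H. apply (filterlim_locally_ball_norm (K := C_AbsRing) (U := C_NormedModule)).
  intros eps. exact (H eps (cond_pos eps)).
Qed.

(** Tube lemma: continuity at each point of [{q0} x [a, b]] is uniform over the segment. *)
Lemma continuous_uniform {U : UniformSpace} (K : U -> R -> C) (q0 : U) (a b : R) :
  a <= b ->
  (forall x, a <= x <= b -> continuous (fun p : U * R => K (fst p) (snd p)) (q0, x)) ->
  forall eps, 0 < eps ->
  locally q0 (fun q => forall x, a <= x <= b -> Cmod (K q x - K q0 x) < eps).
Proof.
intros Hab HK eps Heps.
apply (interval_cover (fun A => locally q0 (fun q => forall x, A x -> Cmod (K q x - K q0 x) < eps))); trivial.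
- intros A B HBA HA. revert HA; apply filter_imp; auto.
- intros A B HA HB. generalize (filter_and _ _ HA HB); apply filter_imp.
  intros q [H1 H2] x [H|H]; auto.
- intros x Hx.
  destruct (proj1 (continuous_C_eps _ _) (HK x Hx) (eps / 2)) as [d Hd]; [lra|].
  exists d; split; [apply cond_pos|].
  exists d. intros q Hq y Hy.
  replace (K q y - K q0 y)%C with ((K q y - K q0 x) - (K q0 y - K q0 x))%C by ring.
  eapply Rle_lt_trans; [apply Cmod_triangle|]. rewrite Cmod_opp.
  generalize (Hd (q, y) (conj Hq Hy)) (Hd (q0, y) (conj (ball_center q0 d) Hy)). simpl. lra.
Qed.

Lemma continuous_curry {U : UniformSpace} (K : U -> R -> C) (q : U) (x : R) :
  continuous (fun p : U * R => K (fst p) (snd p)) (q, x) -> continuous (K q) x.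
Proof.
intros H. apply (continuous_comp_2 (fun _ => q) (fun y => y) K); trivial.
- apply continuous_const.
- apply continuous_id.
Qed.

Lemma bounded_on_interval (g : R -> C) (a b : R) :
  a <= b -> (forall x, a <= x <= b -> continuous g x) ->
  exists M, forall x, a <= x <= b -> Cmod (g x) <= M.
Proof.
intros Hab Hg.
apply (interval_cover (fun A => exists M, forall x, A x -> Cmod (g x) <= M)); trivial.
- intros A B HBA [M HM]; exists M; auto.
- intros A B [M1 H1] [M2 H2]; exists (Rmax M1 M2). intros x [H|H].
  + eapply Rle_trans; [apply H1, H|apply Rmax_l].
  + eapply Rle_trans; [apply H2, H|apply Rmax_r].
- intros x Hx. destruct (proj1 (continuous_C_eps _ _) (Hg x Hx) 1 Rlt_0_1) as [d Hd].
  exists d; split; [apply cond_pos|]. exists (1 + Cmod (g x)). intros y Hy.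
  replace (g y) with ((g y - g x) + g x)%C by ring.
  eapply Rle_trans; [apply Cmod_triangle|]. specialize (Hd y Hy). lra.
Qed.

Lemma bounded_on_rectangle (K : R -> R -> C) (a b c d : R) :
  a <= b -> c <= d ->
  (forall p : R * R, continuous (fun p : R * R => K (fst p) (snd p)) p) ->
  exists M, forall x y, a <= x <= b -> c <= y <= d -> Cmod (K x y) <= M.
Proof.
intros Hab Hcd HK.
cut (exists M, forall x, a <= x <= b -> forall y, c <= y <= d -> Cmod (K x y) <= M).
{ intros [M HM]; exists M; auto. }
apply (interval_cover (fun A => exists M, forall x, A x -> forall y, c <= y <= d -> Cmod (K x y) <= M)); trivial.
- intros A B HBA [M HM]; exists M; auto.
- intros A B [M1 H1] [M2 H2]; exists (Rmax M1 M2). intros x [H|H] y Hy.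
  + eapply Rle_trans; [apply H1; trivial|apply Rmax_l].
  + eapply Rle_trans; [apply H2; trivial|apply Rmax_r].
- intros x Hx.
  destruct (continuous_uniform K x c d Hcd (fun y _ => HK (x, y)) 1 Rlt_0_1) as [e He].
  destruct (bounded_on_interval (K x) c d Hcd) as [M HM].
  { intros y _. apply continuous_curry, HK. }
  exists e; split; [apply cond_pos|]. exists (1 + M). intros x' Hx' y Hy.
  replace (K x' y) with ((K x' y - K x y) + K x y)%C by ring.
  eapply Rle_trans; [apply Cmod_triangle|].
  specialize (He x' Hx' y Hy). specialize (HM y Hy). lra.
Qed.

Lemma CInt_bound (g : R -> C) (a b M : R) :
  a <= b -> (forall x, continuous g x) -> (forall x, a <= x <= b -> Cmod (g x) <= M) ->
  Cmod (CInt g a b) <= (b - a) * M.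
Proof.
intros Hab Hg HM. rewrite Cmod_norm.
apply (norm_RInt_le (V := C_R_NormedModule) g (fun _ => M) a b _ _ Hab).
- intros x Hx. eapply Rle_trans; [|apply (HM x Hx)]. right. symmetry. apply Cmod_norm.
- apply (RInt_correct (V := C_R_CompleteNormedModule)). apply (ex_RInt_continuous (V := C_R_CompleteNormedModule)). auto.
- apply (is_RInt_const (V := R_NormedModule)).
Qed.

Lemma ex_CInt (g : R -> C) (a b : R) :
  (forall x, continuous g x) -> ex_RInt (V := C_R_NormedModule) g a b.
Proof.
intros Hg. apply (ex_RInt_continuous (V := C_R_CompleteNormedModule)). auto.
Qed.

(** Linearity of [RInt] covers real scalars only; complex ones are handled
    componentwise. *)
Lemma CInt_Cmult (c : C) (g : R -> C) (a b : R) :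
  (forall x, continuous g x) ->
  CInt (fun x => c * g x)%C a b = (c * CInt g a b)%C.
Proof.
intros Hg. apply is_RInt_unique.
assert (H := RInt_correct (V := C_R_CompleteNormedModule) g a b (ex_CInt g a b Hg)).
assert (H1 := is_RInt_fct_extend_fst (U := R_NormedModule) (V := R_NormedModule) g a b _ H).
assert (H2 := is_RInt_fct_extend_snd (U := R_NormedModule) (V := R_NormedModule) g a b _ H).
apply (is_RInt_fct_extend_pair (U := R_NormedModule) (V := R_NormedModule)).
- exact (is_RInt_minus _ _ _ _ _ _ (is_RInt_scal _ _ _ (fst c) _ H1) (is_RInt_scal _ _ _ (snd c) _ H2)).
- exact (is_RInt_plus _ _ _ _ _ _ (is_RInt_scal _ _ _ (fst c) _ H2) (is_RInt_scal _ _ _ (snd c) _ H1)).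
Qed.

Lemma CInt_minus (f g : R -> C) (a b : R) :
  (forall x, continuous f x) -> (forall x, continuous g x) ->
  CInt (fun x => f x - g x)%C a b = (CInt f a b - CInt g a b)%C.
Proof.
intros Hf Hg. apply (RInt_minus (V := C_R_CompleteNormedModule)); apply ex_CInt; trivial.
Qed.

Lemma continuous_C_plus {U : UniformSpace} (f g : U -> C) (x : U) :
  continuous f x -> continuous g x -> continuous (fun y => f y + g y)%C x.
Proof. intros; apply (continuous_plus (V := C_NormedModule)); trivial. Qed.

Lemma continuous_C_minus {U : UniformSpace} (f g : U -> C) (x : U) :
  continuous f x -> continuous g x -> continuous (fun y => f y - g y)%C x.
Proof. intros; apply (continuous_minus (V := C_NormedModule)); trivial. Qed.

Lemma continuous_C_mult {U : UniformSpace} (f g : U -> C) (x : U) :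
  continuous f x -> continuous g x -> continuous (fun y => f y * g y)%C x.
Proof. intros. apply (continuous_scal (V := C_NormedModule) f g); trivial.
 intros P HP. apply locally_C in HP. exact (H P HP).
Qed.

Lemma continuous_CInt {U : UniformSpace} (K : U -> R -> C) (q0 : U) (a b : R) :
  a <= b -> (forall p : U * R, continuous (fun p : U * R => K (fst p) (snd p)) p) ->
  continuous (fun q => CInt (K q) a b) q0.
Proof.
intros Hab HK.
assert (Hc : forall q x, continuous (K q) x) by (intros; apply continuous_curry, HK).
apply continuous_C_eps; intros eps Heps.
assert (He : 0 < eps / (b - a + 1)) by (apply Rdiv_lt_0_compat; lra).
generalize (continuous_uniform K q0 a b Hab (fun x _ => HK (q0, x)) _ He). apply filter_imp.
intros q Hq. rewrite <- CInt_minus by auto.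
eapply Rle_lt_trans.
- apply (CInt_bound _ _ _ (eps / (b - a + 1)) Hab).
  + intros x. apply continuous_C_minus; auto.
  + intros x Hx. apply Rlt_le, Hq, Hx.
- apply Rlt_le_trans with ((b - a + 1) * (eps / (b - a + 1))).
  + apply Rmult_lt_compat_r; lra.
  + right; field; lra.
Qed.

(** Differentiation under the integral sign in a complex parameter: the mean value
    inequality, applied to [K w x - w * dK p0 x], bounds the error of the linear
    approximation uniformly in [x], because [dK] is uniformly close to [dK p0] near
    [p0]. *)
Lemma is_derive_CInt (K dK : C -> R -> C) (p0 : C) (a b : R) :
  a <= b ->
  (forall p x, is_derive_C (fun q => K q x) p (dK p x)) ->
  (forall p x, continuous (K p) x) ->
  (forall x, continuous (fun p : C * R => dK (fst p) (snd p)) (p0, x)) ->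
  is_derive_C (fun p => CInt (K p) a b) p0 (CInt (dK p0) a b).
Proof.
intros Hab HK HKc HdK.
assert (HdKc : forall x, continuous (dK p0) x) by (intros; apply continuous_curry, HdK).
apply is_derive_C_eps; intros eps Heps.
assert (He : 0 < eps / (b - a + 1)) by (apply Rdiv_lt_0_compat; lra).
destruct (continuous_uniform dK p0 a b Hab (fun x _ => HdK x) _ He) as [d Hd].
exists d; split; [apply cond_pos|]; intros p Hp.
rewrite <- CInt_minus, <- CInt_Cmult, <- CInt_minus; auto.
2: { intros x. apply continuous_C_minus; auto. }
2: { intros x. apply continuous_C_mult; auto. apply continuous_const. }
eapply Rle_trans.
- apply (CInt_bound _ _ _ (eps / (b - a + 1) * Cmod (p - p0)) Hab).
  + intros x. apply continuous_C_minus; [apply continuous_C_minus; auto|].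
    apply continuous_C_mult; auto. apply continuous_const.
  + intros x Hx.
    replace (K p x - K p0 x - (p - p0) * dK p0 x)%C with
      ((K p x - p * dK p0 x) - (K p0 x - p0 * dK p0 x))%C by ring.
    apply (segment_growth (fun w => K w x - w * dK p0 x)%C (fun w => dK w x - dK p0 x)%C).
    intros s Hs w; split.
    * apply (is_derive_minus (K := C_AbsRing) (V := C_NormedModule)); [apply HK|].
      apply filterdiff_linear, is_linear_scal_l.
    * apply Rlt_le, Hd; trivial. apply C_NormedModule_mixin_compat1.
      change (Cmod (w - p0) < d). unfold w.
      replace (p0 + RtoC s * (p - p0) - p0)%C with (RtoC s * (p - p0))%C by ring.
      rewrite Cmod_mult, Cmod_R, Rabs_pos_eq by apply Hs.
      generalize (Cmod_ge_0 (p - p0)); nra.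
- apply Rle_trans with ((b - a + 1) * (eps / (b - a + 1)) * Cmod (p - p0)).
  + rewrite <- Rmult_assoc. apply Rmult_le_compat_r; [apply Cmod_ge_0|].
    apply Rmult_le_compat_r; lra.
  + right; field; lra.
Qed.

(** * Cauchy theory on centred circles *)

Definition cis (x : R) : C := (cos x, sin x).

Lemma is_derive_cis (x : R) : is_derive_RC cis x (Ci * cis x)%C.
Proof.
replace (Ci * cis x)%C with (- sin x, cos x).
- apply is_derive_RC_pair; [apply is_derive_cos|apply is_derive_sin].
- apply injective_projections; simpl; ring.
Qed.

Lemma is_derive_cis_conj (x : R) : is_derive_RC (fun y => Cconj (cis y)) x (- Ci * Cconj (cis x))%C.
Proof.
replace (- Ci * Cconj (cis x))%C with (- sin x, - cos x).
- apply is_derive_RC_pair; [apply is_derive_cos|]. apply (is_derive_opp (V := R_NormedModule)), is_derive_sin.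
- apply injective_projections; simpl; ring.
Qed.

Lemma cis_conj (x : R) : (cis x * Cconj (cis x))%C = RtoC 1.
Proof.
apply injective_projections; simpl; [|ring].
rewrite <- (sin2_cos2 x). unfold Rsqr. ring.
Qed.

Lemma Cmod_cis (x : R) : Cmod (cis x) = 1.
Proof.
assert (H := Cmod2_conj (cis x)). rewrite cis_conj in H. apply RtoC_inj in H.
generalize (Cmod_ge_0 (cis x)). nra.
Qed.

Lemma cis_2PI : cis (2 * PI) = cis 0.
Proof. unfold cis. now rewrite cos_2PI, sin_2PI, cos_0, sin_0. Qed.

Lemma is_derive_RC_conj_pow (k : nat) (x : R) :
  is_derive_RC (fun y => Cconj (cis y) ^ S k)%C x (- Ci * RtoC (INR (S k)) * Cconj (cis x) ^ S k)%C.
Proof.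
induction k as [|k IH].
- assert (H := is_derive_cis_conj x).
  eapply is_derive_ext; [intros t; symmetry; apply Cpow_1_r|].
  replace (- Ci * RtoC (INR 1) * Cconj (cis x) ^ 1)%C with (- Ci * Cconj (cis x))%C by (simpl; ring). exact H.
- replace (- Ci * RtoC (INR (S (S k))) * Cconj (cis x) ^ S (S k))%C with
   ((- Ci * Cconj (cis x)) * Cconj (cis x) ^ S k + Cconj (cis x) * (- Ci * RtoC (INR (S k)) * Cconj (cis x) ^ S k))%C.
  + apply (is_derive_RC_mult (fun y => Cconj (cis y)) (fun y => Cconj (cis y) ^ S k)%C); [apply is_derive_cis_conj|exact IH].
  + rewrite (S_INR (S k)), RtoC_plus, (Cpow_S _ (S k)). ring.
Qed.

Lemma continuous_cis (x : R) : continuous cis x.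
Proof. exact (continuous_is_derive_RC _ _ _ (is_derive_cis x)). Qed.

Lemma continuous_cis_conj_pow (k : nat) (x : R) : continuous (fun y => Cconj (cis y) ^ k)%C x.
Proof. destruct k as [|k]; [apply continuous_const|exact (continuous_is_derive_RC _ _ _ (is_derive_RC_conj_pow k x))]. Qed.

Lemma CInt_period (g dg : R -> C) :
  (forall x, is_derive_RC g x (dg x)) -> (forall x, continuous dg x) -> g (2 * PI) = g 0 ->
  CInt dg 0 (2 * PI) = RtoC 0.
Proof.
intros Hg Hc E. apply is_RInt_unique.
replace (RtoC 0) with (minus (g (2 * PI)) (g 0) : C_R_NormedModule).
- apply (is_RInt_derive (V := C_R_CompleteNormedModule)); auto.
- rewrite E. exact (minus_eq_zero (G := C_R_NormedModule) (g 0)).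
Qed.

Lemma continuous_on_circle {U : UniformSpace} (f : C -> C) (a b : U -> C) (p : U * R) :
  (forall w, continuous f w) -> continuous a (fst p) -> continuous b (fst p) ->
  continuous (fun p : U * R => f (a (fst p) + b (fst p) * cis (snd p)))%C p.
Proof.
intros Hf Ha Hb. apply (continuous_comp (fun p : U * R => a (fst p) + b (fst p) * cis (snd p))%C f); [|apply Hf].
destruct p as [q x].
apply continuous_C_plus; [|apply continuous_C_mult].
- apply (continuous_comp fst a); [apply continuous_fst|exact Ha].
- apply (continuous_comp fst b); [apply continuous_fst|exact Hb].
- apply (continuous_comp snd cis); [apply continuous_snd|apply continuous_cis].
Qed.

Lemma continuous_on_fixed_circle (f : C -> C) (a b : C) (x : R) :
  (forall w, continuous f w) -> continuous (fun x => f (a + b * cis x))%C x.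
Proof.
intros Hf.
apply (continuous_curry (fun (_ : C) x => f (a + b * cis x)%C) (RtoC 0) x).
apply (continuous_on_circle f (fun _ => a) (fun _ => b)); trivial; apply continuous_const.
Qed.

(** Up to the factor [2 PI], the [k]-th Fourier coefficient of [f] on the circle of
    centre [z] and radius [p].  The radius is allowed to be complex so that
    differentiation in the radius is also complex differentiation. *)
Definition circle_moment (f : C -> C) (k : nat) (z p : C) : C :=
  CInt (fun x => f (z + p * cis x) * Cconj (cis x) ^ k)%C 0 (2 * PI).

Lemma is_derive_circle (f : C -> C) (z p d : C) (x : R) :
  is_derive_C f (z + p * cis x)%C d ->
  is_derive_RC (fun x => f (z + p * cis x))%C x (p * (Ci * cis x) * d)%C.
Proof.
intros H. apply (is_derive_comp_RC f (fun x => z + p * cis x)%C); [exact H|].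
replace (p * (Ci * cis x))%C with (RtoC 0 + (RtoC 0 * cis x + p * (Ci * cis x)))%C by ring.
apply (is_derive_plus (V := C_R_NormedModule)); [apply (is_derive_const (V := C_R_NormedModule))|].
apply (is_derive_RC_mult (fun _ => p) cis); [apply (is_derive_const (V := C_R_NormedModule))|apply is_derive_cis].
Qed.

(** Integration by parts in the angle. *)
Lemma circle_moment_parts (f df : C -> C) (k : nat) (z p : C) :
  (forall w, is_derive_C f w (df w)) -> (forall w, continuous df w) ->
  (p * circle_moment df k z p)%C = (RtoC (INR (S k)) * circle_moment f (S k) z p)%C.
Proof.
intros Hf Hdf.
assert (Hfc : forall w, continuous f w) by (intros w; exact (continuous_is_derive_C f w _ (Hf w))).
assert (C1 : forall x, continuous (fun x => df (z + p * cis x) * Cconj (cis x) ^ k)%C x).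
{ intros x. apply continuous_C_mult; [apply continuous_on_fixed_circle, Hdf|apply continuous_cis_conj_pow]. }
assert (C2 : forall x, continuous (fun x => f (z + p * cis x) * Cconj (cis x) ^ S k)%C x).
{ intros x. apply continuous_C_mult; [apply continuous_on_fixed_circle, Hfc|apply continuous_cis_conj_pow]. }
assert (C3 : forall c (g : R -> C), (forall x, continuous g x) -> forall x, continuous (fun x => c * g x)%C x).
{ intros c g Hg x. apply continuous_C_mult; [apply continuous_const|apply Hg]. }
cut (p * circle_moment df k z p - RtoC (INR (S k)) * circle_moment f (S k) z p = RtoC 0)%C.
{ intros E. rewrite <- (Cplus_0_l (_ * circle_moment f _ _ _)), <- E. ring. }
unfold circle_moment. rewrite <- !CInt_Cmult, <- CInt_minus; auto.
apply CInt_period with (g := fun x => (- Ci * (f (z + p * cis x) * Cconj (cis x) ^ S k))%C).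
- intros x.
  assert (D := is_derive_RC_mult (fun _ => - Ci)%C _ _ _ _ (is_derive_const (V := C_R_NormedModule) _ x)
    (is_derive_RC_mult _ _ _ _ _ (is_derive_circle f z p _ x (Hf _)) (is_derive_RC_conj_pow k x))).
  match type of D with is_derive_RC _ _ ?d =>
   match goal with |- is_derive_RC _ _ ?e => replace e with d; [exact D|] end end.
  change (zero : C_R_NormedModule) with (RtoC 0).
  rewrite Cpow_S.
  transitivity ((- (Ci * Ci)) * (p * df (z + p * cis x) * ((cis x * Cconj (cis x)) * Cconj (cis x) ^ k) -
     RtoC (INR (S k)) * (f (z + p * cis x) * (Cconj (cis x) * Cconj (cis x) ^ k))))%C; [ring|].
  rewrite cis_conj. replace (Ci * Ci)%C with (- RtoC 1)%C; [ring|].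
  apply injective_projections; simpl; ring.
- intros x. apply continuous_C_minus; auto.
- now rewrite cis_2PI.
Qed.

Lemma circle_moment_derive (f df : C -> C) (k : nat) (z p : C) :
  (forall w, is_derive_C f w (df w)) -> (forall w, continuous df w) ->
  is_derive_C (fun w => circle_moment f k w p) z (circle_moment df k z p).
Proof.
intros Hf Hdf.
assert (Hfc : forall w, continuous f w) by (intros w; exact (continuous_is_derive_C f w _ (Hf w))).
assert (PI0 := PI_RGT_0).
apply (is_derive_CInt (fun w x => f (w + p * cis x) * Cconj (cis x) ^ k)%C
  (fun w x => df (w + p * cis x) * Cconj (cis x) ^ k)%C); [lra| | |].
- intros w x.
  replace (df (w + p * cis x)%C * Cconj (cis x) ^ k)%C with
    (Cconj (cis x) ^ k * (RtoC 1 * df (p * cis x + w * RtoC 1)))%C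
    by (rewrite Cmult_1_r, (Cplus_comm w); ring).
  apply is_derive_ext with (fun w => Cconj (cis x) ^ k * f (p * cis x + w * RtoC 1))%C.
  { intros v. rewrite Cmult_1_r, (Cplus_comm v). apply Cmult_comm. }
  apply is_derive_C_scal, is_derive_C_affine, Hf.
- intros w x. apply continuous_C_mult; [apply continuous_on_fixed_circle, Hfc|apply continuous_cis_conj_pow].
- intros x. apply continuous_C_mult.
  + apply (continuous_on_circle df (fun w => w) (fun _ => p) (z, x)); [apply Hdf|apply continuous_id|apply continuous_const].
  + apply (continuous_comp snd (fun x => Cconj (cis x) ^ k)%C); [apply continuous_snd|apply continuous_cis_conj_pow].
Qed.

(** For [p <> 0] the integrand is the angular derivative of
    [f (z + p e^(ix)) / (i p)], which is periodic; for [p = 0] it is a multiple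
    of [e^(ix)]. *)
Lemma CInt_circle_derivative (f df : C -> C) (z p : C) :
  (forall w, is_derive_C f w (df w)) -> (forall w, continuous df w) ->
  CInt (fun x => cis x * df (z + p * cis x))%C 0 (2 * PI) = RtoC 0.
Proof.
intros Hf Hdf.
assert (Cc : forall x, continuous (fun x => cis x * df (z + p * cis x))%C x).
{ intros x. apply continuous_C_mult; [apply continuous_cis|apply continuous_on_fixed_circle, Hdf]. }
destruct (Ceq_dec p (RtoC 0)) as [E|Hp].
2: {
  apply CInt_period with (g := fun x => (/ (p * Ci) * f (z + p * cis x))%C); trivial; [|now rewrite cis_2PI].
  intros x.
  assert (D := is_derive_RC_mult (fun _ => / (p * Ci))%C _ _ _ _
    (is_derive_const (V := C_R_NormedModule) _ x) (is_derive_circle f z p _ x (Hf _))).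
  match type of D with is_derive_RC _ _ ?d =>
   match goal with |- is_derive_RC _ _ ?e => replace e with d; [exact D|] end end.
  change (zero : C_R_NormedModule) with (RtoC 0). field. split; [|exact Hp].
  intros E; apply (f_equal snd) in E; simpl in E; lra. }
apply CInt_period with (g := fun x => (- Ci * df z * cis x)%C); trivial; [|now rewrite cis_2PI].
intros x.
assert (D := is_derive_RC_mult (fun _ => - Ci * df z)%C _ _ _ _ (is_derive_const (V := C_R_NormedModule) _ x) (is_derive_cis x)).
match type of D with is_derive_RC _ _ ?d =>
   match goal with |- is_derive_RC _ _ ?e => replace e with d; [exact D|] end end.
change (zero : C_R_NormedModule) with (RtoC 0). rewrite E.
replace (z + RtoC 0 * cis x)%C with z by ring.
transitivity (- (Ci * Ci) * (cis x * df z))%C; [ring|].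
replace (Ci * Ci)%C with (- RtoC 1)%C; [ring|].
apply injective_projections; simpl; ring.
Qed.

(** The derivative of the mean in the radius vanishes by [CInt_circle_derivative], so
    the mean equals its value for the radius 0. *)
Lemma circle_mean_value (f df : C -> C) (z p : C) :
  (forall w, is_derive_C f w (df w)) -> (forall w, continuous df w) ->
  circle_moment f 0 z p = (RtoC (2 * PI) * f z)%C.
Proof.
intros Hf Hdf.
assert (PI0 := PI_RGT_0).
assert (Hfc : forall w, continuous f w) by (intros w; exact (continuous_is_derive_C f w _ (Hf w))).
assert (E0 : circle_moment f 0 z (RtoC 0) = (RtoC (2 * PI) * f z)%C).
{ unfold circle_moment. rewrite (RInt_ext (V := C_R_CompleteNormedModule) _ (fun _ => f z)).
  - rewrite (RInt_const (V := C_R_CompleteNormedModule)).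
    rewrite Rminus_0_r. change ((2 * PI * fst (f z), 2 * PI * snd (f z)) = (RtoC (2 * PI) * f z)%C).
    apply injective_projections; simpl; ring.
  - intros x _. simpl. cbv beta. replace (z + RtoC 0 * cis x)%C with z by ring. apply Cmult_1_r. }
rewrite <- E0. apply Ceq_minus, Cmod_eq_0, Rle_antisym; [|apply Cmod_ge_0].
apply Rle_trans with (0 * Cmod (p - RtoC 0)); [|rewrite Rmult_0_l; apply Rle_refl].
apply (segment_growth (fun q => circle_moment f 0 z q) (fun _ => RtoC 0)).
intros s _ q. split; [|rewrite Cmod_0; apply Rle_refl].
rewrite <- (CInt_circle_derivative f df z q Hf Hdf).
apply (is_derive_CInt (fun w x => f (z + w * cis x) * Cconj (cis x) ^ 0)%C
  (fun w x => cis x * df (z + w * cis x))%C); [lra| | |].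
- intros w x. apply is_derive_ext with (fun w => f (z + w * cis x)%C).
  { intros v. symmetry. apply Cmult_1_r. }
  apply is_derive_C_affine, Hf.
- intros w x. apply continuous_C_mult; [apply continuous_on_fixed_circle, Hfc|apply continuous_const].
- intros x. apply continuous_C_mult.
  + apply (continuous_comp snd cis); [apply continuous_snd|apply continuous_cis].
  + apply (continuous_on_circle df (fun _ => z) (fun w => w) (q, x)); [apply Hdf|apply continuous_const|apply continuous_id].
Qed.

(** A holomorphic function together with all its derivatives.  Carrying the derivatives
    along as data avoids a total operator of iterated differentiation. *)
Definition derivative_chain (u : nat -> C -> C) : Prop :=
  forall k z, is_derive_C (u k) z (u (S k) z).

(** Cauchy's integral for the [k]-th derivative at the centre of the circle. *)
Definition cauchy_derivative (f : C -> C) (r : R) (k : nat) (z : C) : C :=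
  (RtoC (INR (fact k) / (2 * PI * r ^ k)) * circle_moment f k z (RtoC r))%C.

Lemma derivative_chain_unique (u v : nat -> C -> C) :
  derivative_chain u -> derivative_chain v -> (forall z, u O z = v O z) ->
  forall k z, u k z = v k z.
Proof.
intros Hu Hv E0; induction k as [|k IH]; [exact E0|]; intros z.
apply (is_derive_C_unique (u k) z); [apply Hu|].
apply is_derive_ext with (v k); [intros w; symmetry; apply IH|apply Hv].
Qed.

(** Differentiation under the integral sign produces the moment of [df], which
    integration by parts turns into the next moment of [f]; the factor [(k + 1) / r]
    is the ratio of the two normalisations. *)
Lemma cauchy_derivative_chain (f df : C -> C) (r : R) :
  0 < r -> (forall w, is_derive_C f w (df w)) -> (forall w, continuous df w) ->
  derivative_chain (cauchy_derivative f r).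
Proof.
intros Hr Hf Hdf k z.
assert (PI0 := PI_RGT_0).
assert (Hk : (RtoC r * circle_moment df k z (RtoC r) =
  RtoC (INR (S k)) * circle_moment f (S k) z (RtoC r))%C) by exact (circle_moment_parts f df k z (RtoC r) Hf Hdf).
replace (cauchy_derivative f r (S k) z) with
  (RtoC (INR (fact k) / (2 * PI * r ^ k)) * circle_moment df k z (RtoC r))%C.
- apply is_derive_C_scal, circle_moment_derive; trivial.
- unfold cauchy_derivative.
  assert (Hrk : r ^ k <> 0) by (apply pow_nonzero; lra).
  replace (INR (fact k) / (2 * PI * r ^ k)) with (INR (fact k) / (2 * PI * r ^ S k) * r) by (simpl; field; repeat split; lra).
  replace (INR (fact (S k)) / (2 * PI * r ^ S k)) with (INR (fact k) / (2 * PI * r ^ S k) * INR (S k)).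
  + rewrite !RtoC_mult, <- !Cmult_assoc, Hk. reflexivity.
  + rewrite fact_simpl, mult_INR. simpl pow. field. repeat split; lra.
Qed.

Lemma cauchy_derivative_0 (f df : C -> C) (r : R) (z : C) :
  (forall w, is_derive_C f w (df w)) -> (forall w, continuous df w) ->
  cauchy_derivative f r 0 z = f z.
Proof.
intros Hf Hdf. assert (PI0 := PI_RGT_0).
unfold cauchy_derivative. rewrite (circle_mean_value f df) by trivial.
rewrite Cmult_assoc, <- RtoC_mult. simpl.
replace (1 / (2 * PI * 1) * (2 * PI)) with 1 by (field; lra). apply Cmult_1_l.
Qed.

Lemma derivative_chain_continuous (u : nat -> C -> C) :
  derivative_chain u -> forall k z, continuous (u k) z.
Proof. intros Hu k z. exact (continuous_is_derive_C _ _ _ (Hu k z)). Qed.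

(** As the derivatives do not depend on [r], the radius may be chosen at will in
    Cauchy's estimates. *)
Lemma derivative_chain_cauchy (u : nat -> C -> C) (r : R) (k : nat) (z : C) :
  derivative_chain u -> 0 < r -> u k z = cauchy_derivative (u O) r k z.
Proof.
intros Hu Hr.
assert (C1 := derivative_chain_continuous u Hu 1%nat).
revert k z; apply derivative_chain_unique; trivial.
- apply (cauchy_derivative_chain _ (u 1%nat)); trivial.
- intros z. symmetry. apply cauchy_derivative_0 with (u 1%nat); trivial.
Qed.

Lemma cauchy_estimate (u : nat -> C -> C) (r M : R) (k : nat) (z : C) :
  derivative_chain u -> 0 < r ->
  (forall x, 0 <= x <= 2 * PI -> Cmod (u O (z + RtoC r * cis x)%C) <= M) ->
  Cmod (u k z) <= INR (fact k) / r ^ k * M.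
Proof.
intros Hu Hr HM. assert (PI0 := PI_RGT_0).
rewrite (derivative_chain_cauchy u r k z Hu Hr). unfold cauchy_derivative.
assert (Hrk : 0 < r ^ k) by (apply pow_lt; lra).
assert (Hk := INR_fact_lt_0 k).
rewrite Cmod_mult, Cmod_R, Rabs_pos_eq.
2: { apply Rlt_le, Rdiv_lt_0_compat; nra. }
apply Rle_trans with (INR (fact k) / (2 * PI * r ^ k) * ((2 * PI - 0) * M)).
2: { right. field. lra. }
apply Rmult_le_compat_l.
{ apply Rlt_le, Rdiv_lt_0_compat; nra. }
apply CInt_bound; [lra| |].
- intros x. apply continuous_C_mult; [apply continuous_on_fixed_circle, derivative_chain_continuous, Hu|apply continuous_cis_conj_pow].
- intros x Hx. rewrite Cmod_mult, Cmod_pow, Cmod_conj, Cmod_cis, pow1, Rmult_1_r. auto.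
Qed.

(** [path_growth] along the segment from [a] to [a + b], applied in turn to [u_(N-1)],
    [u_(N-2)], down to [u_0]. *)
Lemma taylor_bound (u : nat -> C -> C) (a b : C) (N : nat) (B : R) :
  derivative_chain u -> (forall k, (k < N)%nat -> u k a = RtoC 0) ->
  (forall s, 0 <= s <= 1 -> Cmod (u N (a + RtoC s * b)%C) <= B) ->
  Cmod (u O (a + b)%C) <= B * Cmod b ^ N / INR (fact N).
Proof.
intros Hu Ha HB.
assert (H : forall j, (j <= N)%nat -> forall s, 0 <= s <= 1 ->
  Cmod (u (N - j)%nat (a + RtoC s * b)%C) <= B * Cmod b ^ j * s ^ j / INR (fact j)).
{ induction j as [|j IH]; intros Hj s Hs.
  - rewrite Nat.sub_0_r. simpl. unfold Rdiv. rewrite Rinv_1, !Rmult_1_r. auto.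
  - assert (Hfj := INR_fact_lt_0 j).
    assert (G := path_growth (fun s => u (N - S j)%nat (a + RtoC s * b)%C)
      (fun s => b * u (N - j)%nat (a + RtoC s * b))%C (B * Cmod b ^ S j / INR (fact j)) j s (proj1 Hs)).
    cbv beta in G.
    replace (a + RtoC 0 * b)%C with a in G by ring.
    rewrite Ha in G by lia.
    unfold Cminus in G; rewrite Copp_0, Cplus_0_r in G.
    replace (B * Cmod b ^ S j * s ^ S j / INR (fact (S j))) with (B * Cmod b ^ S j / INR (fact j) * s ^ S j / INR (S j)).
    2: { rewrite fact_simpl, mult_INR. field. split; [lra|]. apply not_0_INR. lia. }
    apply G.
    + intros x Hx. apply (is_derive_comp_RC (u (N - S j)%nat) (fun s => a + RtoC s * b)%C); [|apply is_derive_segment].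
      replace (N - j)%nat with (S (N - S j)) by lia. apply Hu.
    + intros x Hx. rewrite Cmod_mult.
      replace (B * Cmod b ^ S j / INR (fact j) * x ^ j) with (Cmod b * (B * Cmod b ^ j * x ^ j / INR (fact j))) by (simpl; field; lra).
      apply Rmult_le_compat_l; [apply Cmod_ge_0|]. apply IH; [lia|lra]. }
specialize (H N (le_n N) 1 (conj Rle_0_1 (Rle_refl 1))).
rewrite Nat.sub_diag, Cmult_1_l, pow1, Rmult_1_r in H. exact H.
Qed.

(** Identity theorem.  Put [b = z - a] and [r = 2 |b| + 1].  Cauchy's estimate on circles
    of radius [r] centred on the segment from [a] to [z] bounds the [N]-th derivative by
    [N! M / r^N], and Taylor's estimate then gives [|u_0 z| <= M (|b| / r)^N], which
    tends to 0.  No connectedness argument is needed since [r] is arbitrary. *)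
Lemma derivative_chain_zero (u : nat -> C -> C) (a : C) :
  derivative_chain u -> (forall k, u k a = RtoC 0) -> forall z, u O z = RtoC 0.
Proof.
intros Hu Ha z. assert (PI0 := PI_RGT_0).
set (b := (z - a)%C). replace z with (a + b)%C by (unfold b; ring).
assert (Hb := Cmod_ge_0 b).
set (r := 2 * Cmod b + 1). assert (Hr : 0 < r) by (unfold r; lra).
destruct (bounded_on_rectangle (fun s x => u O ((a + RtoC s * b) + RtoC r * cis x)%C) 0 1 0 (2 * PI)) as [M HM]; [lra|lra| |].
{ intros p. apply (continuous_on_circle (u O) (fun s : R => a + RtoC s * b)%C (fun _ => RtoC r)).
  - apply derivative_chain_continuous, Hu.
  - exact (continuous_is_derive_RC _ _ _ (is_derive_segment a b (fst p))).
  - apply continuous_const. }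
assert (HN : forall N, Cmod (u O (a + b)%C) <= M * (/ 2) ^ N).
{ intros N.
  assert (T := taylor_bound u a b N (INR (fact N) / r ^ N * M) Hu (fun k _ => Ha k)).
  assert (Hrk : 0 < r ^ N) by (apply pow_lt; lra).
  eapply Rle_trans; [apply T|].
  - intros s Hs. apply cauchy_estimate; trivial. intros x Hx. apply HM; trivial.
  - replace (INR (fact N) / r ^ N * M * Cmod b ^ N / INR (fact N)) with (M * (Cmod b / r) ^ N).
    + apply Rmult_le_compat_l.
      * eapply Rle_trans; [apply Cmod_ge_0|apply (HM 0 0); lra].
      * apply pow_incr. split.
        -- apply Rmult_le_pos; [lra|]. apply Rlt_le, Rinv_0_lt_compat, Hr.
        -- apply Rmult_le_reg_r with r; [lra|]. unfold Rdiv. rewrite Rmult_assoc, Rinv_l by lra. unfold r. lra.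
    + unfold Rdiv. rewrite Rpow_mult_distr, pow_inv. field. split; [apply INR_fact_neq_0|lra]. }
apply Cmod_eq_0.
destruct (Rle_lt_or_eq_dec _ _ (Cmod_ge_0 (u O (a + b)%C))) as [L|E]; [|now symmetry].
exfalso.
assert (HM0 : 0 < M) by (specialize (HN O); simpl in HN; lra).
destruct (pow_lt_1_zero (/ 2)) with (y := Cmod (u O (a + b)%C) / M) as [N HN'].
- rewrite Rabs_pos_eq; lra.
- apply Rdiv_lt_0_compat; lra.
- specialize (HN' N (le_n N)). specialize (HN N).
  rewrite Rabs_pos_eq in HN' by (apply pow_le; lra).
  apply (Rmult_lt_compat_l M) in HN'; trivial.
  replace (M * (Cmod (u O (a + b)%C) / M)) with (Cmod (u O (a + b)%C)) in HN' by (field; lra).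
  lra.
Qed.

(** * The derivatives of a solution of the heat equation *)

(** The successive [z]-derivatives of a solution of the heat equation. *)
Definition heat_chain (u : nat -> C -> C -> C) : Prop :=
  forall k t z,
    is_derive_C (fun w => u k t w) z (u (S k) t z) /\
    is_derive_C (fun s => u k s z) t (u (S (S k)) t z).

Definition continuous_chain (u : nat -> C -> C -> C) : Prop :=
  forall k p, continuous (fun p : C * C => u k (fst p) (snd p)) p.

Lemma entire2_continuous (F : C * C -> C) (p : C * C) : entire2 F -> continuous F p.
Proof.
intros HF.
exact (filterdiff_continuous (K := C_AbsRing)
  (U := prod_NormedModule C_AbsRing C_NormedModule C_NormedModule) (V := C_NormedModule) F p (HF p)).
Qed.

(** The total operator in [partial_z] is legitimate here: joint differentiability
    restricts to differentiability along the line [t] constant. *)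
Lemma entire2_derive_z (F : C * C -> C) (t z : C) :
  entire2 F -> is_derive_C (fun w => F (t, w)) z (partial_z F (t, z)).
Proof.
intros HF. apply C_derive_correct; [exact z|].
destruct (HF (t, z)) as [l Hl].
exists (l (RtoC 0, RtoC 1)).
assert (Hid : filterdiff (K := C_AbsRing) (U := AbsRing_NormedModule C_AbsRing) (V := C_NormedModule)
  (fun w : C => w) (locally (T := AbsRing_UniformSpace C_AbsRing) z) (fun w => w)).
{ apply filterdiff_linear, Build_is_linear; [reflexivity|reflexivity|].
  exists 1; split; [lra|]. intros x. rewrite Rmult_1_l. apply Rle_refl. }
assert (H := filterdiff_comp'_2 (K := C_AbsRing) (T := AbsRing_NormedModule C_AbsRing)
  (U := C_NormedModule) (V := C_NormedModule) (W := C_NormedModule)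
  (fun _ => t) (fun w => w) (fun a b => F (a, b)) z _ _ (fun a b => l (a, b))
  (filterdiff_const (V := C_NormedModule) t) Hid).
eapply filterdiff_ext_lin; [apply H|].
- apply filterdiff_ext with F; [now intros [a b]|].
  apply filterdiff_ext_lin with l; [exact Hl|]. now intros [a b].
- intros y. destruct Hl as [Hl _].
  transitivity (scal (y : C_AbsRing) (l (RtoC 0, RtoC 1))); [|reflexivity].
  rewrite <- (linear_scal l Hl). f_equal.
  apply injective_projections; simpl; unfold scal; simpl; unfold mult; simpl; [|now rewrite Cmult_1_r].
  now rewrite Cmult_0_r.
Qed.

Lemma continuous_pair {T U V : UniformSpace} (f : T -> U) (g : T -> V) (x : T) :
  continuous f x -> continuous g x -> continuous (fun y => (f y, g y)) x.
Proof.
intros Hf Hg. apply (continuous_comp_2 f g (fun a b => (a, b))); trivial.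
eapply continuous_ext; [|apply continuous_id]. now intros [a b].
Qed.

(** The [u_k] are Cauchy integrals of [F (t, .)] over circles of radius 1, hence jointly
    continuous since [F] is.  In particular [F_t = F_zz = u_2] is jointly continuous, which
    allows differentiation in [t] under the integral sign: [d/dt u_k] is the
    [k]-th Cauchy integral of [u_2 (t, .)], that is [u_(k+2)]. *)
Lemma heat_chain_of_solution (F : C * C -> C) :
  entire2 F -> heat_equation F ->
  exists u, heat_chain u /\ continuous_chain u /\
    (forall t z, u O t z = F (t, z)).
Proof.
intros HF Hheat. assert (PI0 := PI_RGT_0).
set (u := fun k t => cauchy_derivative (fun w => F (t, w)) 1 k).
assert (HFz := fun t z => entire2_derive_z F t z HF).
assert (HFzc : forall t z, continuous (fun w => partial_z F (t, w)) z).
{ intros t z. destruct (Hheat t z) as [d [_ Hd]]. exact (continuous_is_derive_C _ _ _ Hd). }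
assert (Hu0 : forall t z, u O t z = F (t, z)).
{ intros t z. exact (cauchy_derivative_0 _ _ 1 z (HFz t) (HFzc t)). }
assert (Huz : forall t, derivative_chain (fun k => u k t)).
{ intros t. exact (cauchy_derivative_chain _ _ 1 Rlt_0_1 (HFz t) (HFzc t)). }
assert (Hu1 : forall t z, u 1%nat t z = partial_z F (t, z)).
{ intros t z. apply (is_derive_C_unique (u O t) z); [apply Huz|].
  apply is_derive_ext with (fun w => F (t, w)); [intros w; symmetry; apply Hu0|apply HFz]. }
assert (Hut : forall t z, is_derive_C (fun s => F (s, z)) t (u 2%nat t z)).
{ intros t z. destruct (Hheat t z) as [d [Ht Hd]].
  replace (u 2%nat t z) with d; [exact Ht|].
  apply (is_derive_C_unique (u 1%nat t) z); [|apply Huz].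
  apply is_derive_ext with (fun w => partial_z F (t, w)); [intros w; symmetry; apply Hu1|exact Hd]. }
(* Joint continuity of the integrands, in the form needed both for the parameter
   [(t, z)] and for the parameter [t] alone. *)
assert (Hcirc : forall (G : C * C -> C), (forall p, continuous G p) ->
  forall k (U : UniformSpace) (a b : U -> C), (forall q, continuous a q) -> (forall q, continuous b q) ->
  forall p : U * R, continuous
    (fun p : U * R => G (a (fst p), b (fst p) + RtoC 1 * cis (snd p)) * Cconj (cis (snd p)) ^ k)%C p).
{ intros G HG k U a b Ha Hb [q x]. apply continuous_C_mult.
  - apply (continuous_comp (fun p : U * R => (a (fst p), b (fst p) + RtoC 1 * cis (snd p))%C) G); [|apply HG].
    apply continuous_pair.
    + apply (continuous_comp fst a); [apply continuous_fst|apply Ha].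
    + apply (continuous_on_circle (fun w => w) b (fun _ => RtoC 1) (q, x));
        [intros w; apply continuous_id|apply Hb|apply continuous_const].
  - apply (continuous_comp snd (fun x => Cconj (cis x) ^ k)%C); [apply continuous_snd|apply continuous_cis_conj_pow]. }
assert (HFc := fun p => entire2_continuous F p HF).
assert (Huc : forall k p, continuous (fun p : C * C => u k (fst p) (snd p)) p).
{ intros k p. apply continuous_C_mult; [apply continuous_const|].
  apply (continuous_CInt (fun (q : C * C) x =>
    F (fst q, snd q + RtoC 1 * cis x) * Cconj (cis x) ^ k)%C p); [lra|].
  apply (Hcirc F HFc k _ (fun q : C * C => fst q) (fun q : C * C => snd q));
    intros [a b]; [apply continuous_fst|apply continuous_snd]. }
exists u; split; [|split; trivial].
intros k t z; split; [apply Huz|].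
replace (u (S (S k)) t z) with (cauchy_derivative (u 2%nat t) 1 k z).
- apply is_derive_C_scal.
  apply (is_derive_CInt (fun s x => F (s, z + RtoC 1 * cis x) * Cconj (cis x) ^ k)%C
    (fun s x => u 2%nat s (z + RtoC 1 * cis x) * Cconj (cis x) ^ k)%C); [lra| | |].
  + intros s x. rewrite (Cmult_comm (u 2%nat s _)).
    apply is_derive_ext with (fun s => Cconj (cis x) ^ k * F (s, z + RtoC 1 * cis x))%C; [intros; apply Cmult_comm|].
    apply is_derive_C_scal, Hut.
  + intros s x.
    apply (continuous_curry (fun s x => F (s, z + RtoC 1 * cis x) * Cconj (cis x) ^ k)%C).
    apply (Hcirc F HFc k _ (fun s => s) (fun _ => z)); intros q; [apply continuous_id|apply continuous_const].
  + intros x.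
    apply (Hcirc (fun p => u 2%nat (fst p) (snd p)) (Huc 2%nat) k _ (fun s => s) (fun _ => z)); intros q; [apply continuous_id|apply continuous_const].
- symmetry. apply (derivative_chain_cauchy (fun j => u (S (S j)) t) 1 k z); [|lra].
  intros j w. apply Huz.
Qed.

(** Spread the vanishing along the line [t = t0] with the chain in [z], then along each
    line [z] constant with the chain of even indices in [t]. *)
Lemma heat_chain_zero (u : nat -> C -> C -> C) (t0 z0 : C) :
  heat_chain u -> (forall k, u k t0 z0 = RtoC 0) -> forall t z, u O t z = RtoC 0.
Proof.
intros Hu H0 t z.
assert (Hz : forall k, u k t0 z = RtoC 0).
{ intros k. apply (derivative_chain_zero (fun j => u (j + k)%nat t0) z0).
  - intros j w. apply Hu.
  - intros j. apply H0. }
apply (derivative_chain_zero (fun j s => u (j + j)%nat s z) t0).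
- intros j s. replace (S j + S j)%nat with (S (S (j + j))) by lia. apply Hu.
- intros j. apply Hz.
Qed.

(** * Parabolic scaling and the Euler operator *)

Definition in_cylinder (t0 z0 : C) (rho : R) (t z : C) : Prop :=
  Cmod (t - t0) <= rho ^ 2 /\ Cmod (z - z0) <= rho.

(** Landau's [O(rho ^ e)] for [rho] tending to 0, uniformly on the cylinder of scale
    [rho]. *)
Definition parabolic_O (t0 z0 : C) (g : C -> C -> C) (e : nat) : Prop :=
  exists M, 0 <= M /\ at_right 0 (fun rho => forall t z, in_cylinder t0 z0 rho t z ->
    Cmod (g t z) <= M * rho ^ e).

Lemma at_right_0_lt (c : R) : 0 < c -> at_right 0 (fun rho => 0 < rho < c).
Proof.
intros Hc. exists (mkposreal c Hc). intros rho H Hrho. split; [exact Hrho|].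
unfold ball in H; simpl in H; unfold AbsRing_ball in H; simpl in H.
unfold abs, minus, plus, opp in H; simpl in H. rewrite Rabs_pos_eq in H; lra.
Qed.

Lemma at_right_0_elim (P : R -> Prop) :
  at_right 0 P -> exists r, 0 < r /\ forall rho, 0 < rho < r -> P rho.
Proof.
intros [r Hr]. exists r; split; [apply cond_pos|]. intros rho H. apply Hr; [|apply H].
unfold ball; simpl; unfold AbsRing_ball; simpl.
unfold abs, minus, plus, opp; simpl. rewrite Rabs_pos_eq; lra.
Qed.

Lemma pow_le_pow_of_le_one (x : R) (a b : nat) : 0 <= x <= 1 -> (b <= a)%nat -> x ^ a <= x ^ b.
Proof.
intros Hx Hab. replace a with (b + (a - b))%nat by lia. rewrite pow_add.
assert (0 <= x ^ b) by (apply pow_le; lra).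
assert (x ^ (a - b) <= 1) by (rewrite <- (pow1 (a - b)); apply pow_incr; lra).
nra.
Qed.

Lemma continuous_cylinder (g : C -> C -> C) (t0 z0 : C) (eps : R) :
  continuous (fun p : C * C => g (fst p) (snd p)) (t0, z0) -> 0 < eps ->
  at_right 0 (fun rho => forall t z, in_cylinder t0 z0 rho t z -> Cmod (g t z - g t0 z0) < eps).
Proof.
intros Hg Heps.
destruct (proj1 (continuous_C_eps _ _) Hg eps Heps) as [d Hd].
generalize (filter_and _ _ (at_right_0_lt 1 Rlt_0_1) (at_right_0_lt d (cond_pos d))). apply filter_imp.
intros rho [H1 H2] t z [Ht Hz].
apply (Hd (t, z)). split; apply C_NormedModule_mixin_compat1.
- change (Cmod (t - t0) < d). nra.
- change (Cmod (z - z0) < d). lra.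
Qed.

(** By induction on the order [m - k]: going from [(t0, z0)] to [(t0, z)] and then to
    [(t, z)], the mean value inequality gains a factor [rho] from [v_(k+1)] on the first
    segment and a factor [rho^2] from [v_(k+2)] on the second one.  For [k >= m] the
    subtraction is truncated and the bound is mere local boundedness. *)
Lemma parabolic_O_vanishing (v : nat -> C -> C -> C) (t0 z0 : C) (m : nat) :
  heat_chain v -> continuous_chain v ->
  (forall k, (k < m)%nat -> v k t0 z0 = RtoC 0) ->
  forall k, parabolic_O t0 z0 (v k) (m - k).
Proof.
intros Hv Hc H0.
cut (forall e k, (m - k <= e)%nat -> parabolic_O t0 z0 (v k) (m - k)).
{ intros H k. apply (H (m - k)%nat). lia. }
induction e as [|e IH]; intros k Hk.
- replace (m - k)%nat with O by lia.
  exists (1 + Cmod (v k t0 z0)). split; [generalize (Cmod_ge_0 (v k t0 z0)); lra|].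
  generalize (continuous_cylinder (v k) t0 z0 1 (Hc k (t0, z0)) Rlt_0_1). apply filter_imp.
  intros rho H t z Hin. specialize (H t z Hin). simpl. rewrite Rmult_1_r.
  replace (v k t z) with ((v k t z - v k t0 z0) + v k t0 z0)%C by ring.
  eapply Rle_trans; [apply Cmod_triangle|]. lra.
- destruct (Compare_dec.le_lt_dec (m - k) e) as [L|L]; [now apply IH|].
  destruct (IH (S k)) as [M1 [HM1 H1]]; [lia|].
  destruct (IH (S (S k))) as [M2 [HM2 H2]]; [lia|].
  exists (M1 + M2); split; [lra|].
  generalize (filter_and _ _ (at_right_0_lt 1 Rlt_0_1) (filter_and _ _ H1 H2)). apply filter_imp.
  intros rho [Hrho [B1 B2]] t z [Ht Hz].
  replace (v k t z) with ((v k t z - v k t0 z) + (v k t0 z - v k t0 z0))%C by (rewrite (H0 k) by lia; ring).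
  eapply Rle_trans; [apply Cmod_triangle|].
  assert (Hscale : forall (a b : C) x, 0 <= x <= 1 -> Cmod (a + RtoC x * (b - a) - a)%C <= Cmod (b - a)%C).
  { intros a b x Hx. replace (a + RtoC x * (b - a) - a)%C with (RtoC x * (b - a))%C by ring.
    rewrite Cmod_mult, Cmod_R, Rabs_pos_eq by lra. generalize (Cmod_ge_0 (b - a)%C). nra. }
  assert (Ct : Cmod (v k t z - v k t0 z) <= M2 * rho ^ (m - S (S k)) * Cmod (t - t0)).
  { apply (segment_growth (fun s => v k s z) (fun s => v (S (S k)) s z)).
    intros x Hx w; split; [apply Hv|]. apply B2. split; [|exact Hz].
    eapply Rle_trans; [apply Hscale, Hx|exact Ht]. }
  assert (Cz : Cmod (v k t0 z - v k t0 z0) <= M1 * rho ^ (m - S k) * Cmod (z - z0)).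
  { apply (segment_growth (fun w => v k t0 w) (fun w => v (S k) t0 w)).
    intros x Hx w; split; [apply Hv|]. apply B1. split.
    - replace (t0 - t0)%C with (RtoC 0) by ring. rewrite Cmod_0. nra.
    - eapply Rle_trans; [apply Hscale, Hx|exact Hz]. }
  assert (P1 : 0 <= rho ^ (m - S k)) by (apply pow_le; lra).
  assert (P2 : 0 <= rho ^ (m - S (S k))) by (apply pow_le; lra).
  assert (E1 : rho ^ (m - S k) * rho = rho ^ (m - k)).
  { replace (m - k)%nat with (S (m - S k)) by lia. simpl. ring. }
  assert (E2 : rho ^ (m - S (S k)) * rho ^ 2 <= rho ^ (m - k)).
  { rewrite <- pow_add. apply pow_le_pow_of_le_one; [lra|lia]. }
  assert (Q1 : M1 * rho ^ (m - S k) * Cmod (z - z0) <= M1 * rho ^ (m - k)).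
  { rewrite <- E1, Rmult_assoc. apply Rmult_le_compat_l; [exact HM1|]. now apply Rmult_le_compat_l. }
  assert (Q2 : M2 * rho ^ (m - S (S k)) * Cmod (t - t0) <= M2 * rho ^ (m - k)).
  { rewrite Rmult_assoc. apply Rmult_le_compat_l; [exact HM2|].
    eapply Rle_trans; [|exact E2]. now apply Rmult_le_compat_l. }
  lra.
Qed.

(** The [k]-th [z]-derivative of [z u_z + 2 t u_t - n u] centred at [(t0, z0)]; a
    solution that is quasi-homogeneous of degree [n] makes it zero. *)
Definition euler_defect (t0 z0 : C) (n : nat) (u : nat -> C -> C -> C) (k : nat) (t z : C) : C :=
  ((z - z0) * u (S k) t z + (t - t0) * (RtoC 2 * u (S (S k)) t z)
   - RtoC (INR n - INR k) * u k t z)%C.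

(** The Euler operator preserves solutions, as these are invariant under parabolic
    dilations.  Each derivative in [z] lowers the weight [n - k] by 1 and each derivative
    in [t] lowers it by 2. *)
Lemma euler_defect_chain (t0 z0 : C) (n : nat) (u : nat -> C -> C -> C) :
  heat_chain u -> heat_chain (euler_defect t0 z0 n u).
Proof.
intros Hu k t z.
assert (Hz := fun j => proj1 (Hu j t z)). assert (Ht := fun j => proj2 (Hu j t z)).
split.
- replace (euler_defect t0 z0 n u (S k) t z) with
    ((u (S k) t z + (z - z0) * u (S (S k)) t z) + (t - t0) * (RtoC 2 * u (S (S (S k))) t z)
     - RtoC (INR n - INR k) * u (S k) t z)%C.
  2: { unfold euler_defect. rewrite (S_INR k), !RtoC_minus, RtoC_plus. ring. }
  apply is_derive_C_minus; [|apply is_derive_C_scal, Hz].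
  apply is_derive_C_plus; [|apply is_derive_C_scal, is_derive_C_scal, Hz].
  apply (is_derive_C_mult_id (u (S k) t)), Hz.
- replace (euler_defect t0 z0 n u (S (S k)) t z) with
    ((z - z0) * u (S (S (S k))) t z +
     (RtoC 2 * u (S (S k)) t z + (t - t0) * (RtoC 2 * u (S (S (S (S k)))) t z))
     - RtoC (INR n - INR k) * u (S (S k)) t z)%C.
  2: { unfold euler_defect. rewrite (S_INR (S k)), (S_INR k), !RtoC_minus, !RtoC_plus. ring. }
  apply is_derive_C_minus; [|apply is_derive_C_scal, Ht].
  apply is_derive_C_plus; [apply is_derive_C_scal, Ht|].
  apply (is_derive_C_mult_id (fun s => RtoC 2 * u (S (S k)) s z)%C), is_derive_C_scal, Ht.
Qed.

Lemma euler_defect_continuous (t0 z0 : C) (n : nat) (u : nat -> C -> C -> C) :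
  continuous_chain u -> continuous_chain (euler_defect t0 z0 n u).
Proof.
intros Hu k [t z].
apply continuous_C_minus; [apply continuous_C_plus|].
- apply continuous_C_mult; [|exact (Hu (S k) (t, z))].
  apply continuous_C_minus; [apply continuous_snd|apply continuous_const].
- apply continuous_C_mult.
  + apply continuous_C_minus; [apply continuous_fst|apply continuous_const].
  + apply continuous_C_mult; [apply continuous_const|exact (Hu (S (S k)) (t, z))].
- apply continuous_C_mult; [apply continuous_const|exact (Hu k (t, z))].
Qed.

(** * Isolation of common zeros *)

Definition vanishing_order (u : nat -> C -> C -> C) (t0 z0 : C) (n : nat) : Prop :=
  (forall k, (k < n)%nat -> u k t0 z0 = RtoC 0) /\ u n t0 z0 <> RtoC 0.

(** The coefficient [n - k] vanishes exactly at the first index [k] where [u_k] does not,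
    which gains one order over the order of [u]. *)
Lemma euler_defect_O (u : nat -> C -> C -> C) (t0 z0 : C) (n : nat) :
  heat_chain u -> continuous_chain u -> vanishing_order u t0 z0 n ->
  forall k, parabolic_O t0 z0 (euler_defect t0 z0 n u k) (S n - k).
Proof.
intros Hu Hc [Hlow Hn].
apply parabolic_O_vanishing.
- now apply euler_defect_chain.
- now apply euler_defect_continuous.
- intros k Hk. unfold euler_defect.
  destruct (Nat.eq_dec k n) as [->|Hkn].
  + replace (INR n - INR n) with 0 by ring. ring.
  + rewrite (Hlow k) by lia. ring.
Qed.

Lemma lower_bound_top (u : nat -> C -> C -> C) (t0 z0 : C) (n : nat) :
  continuous_chain u -> vanishing_order u t0 z0 n ->
  at_right 0 (fun rho => forall t z, in_cylinder t0 z0 rho t z -> Cmod (u n t0 z0) / 2 <= Cmod (u n t z)).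
Proof.
intros Hc [Hlow Hn].
assert (HA := proj1 (Cmod_gt_0 _) Hn).
assert (HA2 : 0 < Cmod (u n t0 z0) / 2) by lra.
generalize (continuous_cylinder (u n) t0 z0 _ (Hc n (t0, z0)) HA2). apply filter_imp.
intros rho H t z Hin. specialize (H t z Hin).
assert (T := Cmod_triangle (u n t z) (- (u n t z - u n t0 z0))%C).
rewrite Cmod_opp in T. replace (u n t z + - (u n t z - u n t0 z0))%C with (u n t0 z0) in T by ring. lra.
Qed.

(** Downward use of Euler's relation: with [k = n - j - 1], the term
    [(z - z0) u_(k+1)] has size at least [c rho^(j+1)], the smallness of [d] makes the term in
    [t - t0] at most a quarter of this, and the smallness of [rho] does the same for the
    defect. *)
Lemma lower_bound_small_time (u : nat -> C -> C -> C) (t0 z0 : C) (n : nat) (j : nat) :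
  heat_chain u -> continuous_chain u -> vanishing_order u t0 z0 n -> (j <= n)%nat ->
  exists c d, 0 < c /\ 0 < d <= 1 /\
  at_right 0 (fun rho => forall t z, Cmod (t - t0) <= d * rho ^ 2 -> Cmod (z - z0) = rho ->
    c * rho ^ j <= Cmod (u (n - j)%nat t z)).
Proof.
intros Hu Hc Ho. assert (Hn := proj2 Ho).
induction j as [|j IH]; intros Hj.
- exists (Cmod (u n t0 z0) / 2), 1. assert (HA := proj1 (Cmod_gt_0 _) Hn).
  split; [lra|]. split; [lra|].
  generalize (lower_bound_top u t0 z0 n Hc Ho). apply filter_imp. intros rho H t z Ht Hz.
  rewrite Nat.sub_0_r, Rmult_1_r. apply H. split; lra.
- destruct IH as [c [d [Hc0 [Hd0 IH]]]]; [lia|].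
  set (k := (n - S j)%nat).
  destruct (parabolic_O_vanishing u t0 z0 n Hu Hc (proj1 Ho) (S (S k))) as [M [HM B]].
  destruct (euler_defect_O u t0 z0 n Hu Hc Ho k) as [L [HL BL]].
  exists (c / (2 * INR (S j))), (Rmin d (c / (8 * (M + 1)))).
  assert (Hj0 : 0 < INR (S j)) by (apply lt_0_INR; lia).
  assert (Hd1 : 0 < c / (8 * (M + 1))) by (apply Rdiv_lt_0_compat; lra).
  split; [apply Rdiv_lt_0_compat; lra|].
  split.
  { split; [apply Rmin_pos; lra|]. eapply Rle_trans; [apply Rmin_l|lra]. }
  assert (Hr : 0 < c / (4 * (L + 1))) by (apply Rdiv_lt_0_compat; lra).
  generalize (filter_and _ _ (filter_and _ _ IH (filter_and _ _ B BL))
    (filter_and _ _ (at_right_0_lt 1 Rlt_0_1) (at_right_0_lt _ Hr))).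
  apply filter_imp. clear IH B BL.
  intros rho [[IH [B BL]] [Hrho Hrho2]] t z Ht Hz.
  assert (R2 : 0 < rho ^ 2) by (apply pow_lt; lra).
  assert (Ht1 : Cmod (t - t0) <= d * rho ^ 2).
  { eapply Rle_trans; [exact Ht|]. apply Rmult_le_compat_r; [lra|apply Rmin_l]. }
  assert (Ht2 : Cmod (t - t0) <= c / (8 * (M + 1)) * rho ^ 2).
  { eapply Rle_trans; [exact Ht|]. apply Rmult_le_compat_r; [lra|apply Rmin_r]. }
  assert (Hin : in_cylinder t0 z0 rho t z) by (split; [nra|lra]).
  specialize (IH t z Ht1 Hz). specialize (B t z Hin). specialize (BL t z Hin).
  replace (n - j)%nat with (S k) in IH by (unfold k; lia).
  assert (E : (RtoC (INR (S j)) * u k t z = (z - z0) * u (S k) t z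
    - ((- ((t - t0) * (RtoC 2 * u (S (S k)) t z))) + euler_defect t0 z0 n u k t z))%C).
  { unfold euler_defect. replace (INR n - INR k) with (INR (S j)); [ring|].
    unfold k. rewrite minus_INR by lia. ring. }
  assert (N1 : INR (S j) * Cmod (u k t z) = Cmod (RtoC (INR (S j)) * u k t z)%C).
  { rewrite Cmod_mult, Cmod_R, Rabs_pos_eq; lra. }
  rewrite E in N1.
  set (X := ((z - z0) * u (S k) t z)%C) in *.
  set (Y := (- ((t - t0) * (RtoC 2 * u (S (S k)) t z)))%C) in *.
  set (W := euler_defect t0 z0 n u k t z) in *.
  assert (TX : Cmod X <= INR (S j) * Cmod (u k t z) + (Cmod Y + Cmod W)).
  { rewrite N1. replace X with ((X - (Y + W)) + (Y + W))%C at 1 by ring.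
    eapply Rle_trans; [apply Cmod_triangle|]. apply Rplus_le_compat_l, Cmod_triangle. }
  assert (Pj : 0 < rho ^ S j) by (apply pow_lt; lra).
  assert (BX : c * rho ^ S j <= Cmod X).
  { unfold X. rewrite Cmod_mult, Hz. simpl pow.
    replace (c * (rho * rho ^ j)) with (rho * (c * rho ^ j)) by ring.
    apply Rmult_le_compat_l; lra. }
  assert (BY : Cmod Y <= c / 4 * rho ^ S j).
  { unfold Y. rewrite Cmod_opp, !Cmod_mult, Cmod_R, (Rabs_pos_eq 2) by lra.
    apply Rle_trans with (c / (8 * (M + 1)) * rho ^ 2 * (2 * ((M + 1) * rho ^ (n - S (S k))))).
    - apply Rmult_le_compat; try apply Cmod_ge_0; [|exact Ht2|].
      + generalize (Cmod_ge_0 (u (S (S k)) t z)); lra.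
      + apply Rmult_le_compat_l; [lra|]. eapply Rle_trans; [exact B|].
        apply Rmult_le_compat_r; [apply pow_le; lra|lra].
    - replace (c / (8 * (M + 1)) * rho ^ 2 * (2 * ((M + 1) * rho ^ (n - S (S k)))))
        with (c / 4 * (rho ^ 2 * rho ^ (n - S (S k)))) by (field; lra).
      apply Rmult_le_compat_l; [lra|]. rewrite <- pow_add. apply pow_le_pow_of_le_one; [lra|]. unfold k; lia. }
  assert (BW : Cmod W <= c / 4 * rho ^ S j).
  { eapply Rle_trans; [exact BL|].
    replace (S n - k)%nat with (S (S j)) by (unfold k; lia).
    change (rho ^ S (S j)) with (rho * rho ^ S j).
    rewrite <- Rmult_assoc. apply Rmult_le_compat_r; [lra|].
    apply Rle_trans with (L * (c / (4 * (L + 1)))); [apply Rmult_le_compat_l; lra|].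
    apply Rle_trans with ((L + 1) * (c / (4 * (L + 1)))); [apply Rmult_le_compat_r; lra|].
    right; field; lra. }
  apply Rmult_le_reg_l with (INR (S j)); [exact Hj0|].
  replace (INR (S j) * (c / (2 * INR (S j)) * rho ^ S j)) with (c / 2 * rho ^ S j) by (field; lra).
  lra.
Qed.

(** Upward use of Euler's relation: dividing by [2 (t - t0)], of size at least
    [2 d rho^2], turns bounds one order better than generic on [u_k] and [u_(k+1)] into one
    on [u_(k+2)]. *)
Lemma upper_bound_large_time (u : nat -> C -> C -> C) (t0 z0 : C) (n : nat) (d : R) :
  heat_chain u -> continuous_chain u -> vanishing_order u t0 z0 n -> 0 < d ->
  forall k, (k <= n)%nat ->
  exists M, 0 <= M /\ at_right 0 (fun rho => forall t z, in_cylinder t0 z0 rho t z ->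
    d * rho ^ 2 <= Cmod (t - t0) -> u O t z = RtoC 0 -> u 1%nat t z = RtoC 0 ->
    Cmod (u k t z) <= M * rho ^ (S n - k)).
Proof.
intros Hu Hc Ho Hd.
assert (H0 : forall k, (k < 2)%nat -> exists M, 0 <= M /\ at_right 0 (fun rho => forall t z, in_cylinder t0 z0 rho t z ->
    d * rho ^ 2 <= Cmod (t - t0) -> u O t z = RtoC 0 -> u 1%nat t z = RtoC 0 ->
    Cmod (u k t z) <= M * rho ^ (S n - k))).
{ intros k Hk. exists 0; split; [lra|].
  apply filter_forall. intros rho t z _ _ E0 E1.
  replace (u k t z) with (RtoC 0); [rewrite Cmod_0; lra|].
  destruct k as [|[|k]]; [now symmetry|now symmetry|lia]. }
induction k as [k IH] using lt_wf_ind. intros Hk.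
destruct k as [|[|k]]; [apply H0; lia|apply H0; lia|].
destruct (IH k) as [M0 [HM0 B0]]; [lia|lia|].
destruct (IH (S k)) as [M1 [HM1 B1]]; [lia|lia|].
destruct (euler_defect_O u t0 z0 n Hu Hc Ho k) as [L [HL BL]].
exists ((M1 + L + INR n * M0) / (2 * d)).
assert (Hn0 := pos_INR n).
split. { apply Rmult_le_pos; [nra|]. apply Rlt_le, Rinv_0_lt_compat; lra. }
generalize (filter_and _ _ (filter_and _ _ B0 B1) (filter_and _ _ BL (at_right_0_lt 1 Rlt_0_1))).
apply filter_imp. clear B0 B1 BL IH H0.
intros rho [[B0 B1] [BL Hrho]] t z Hin Ht E0 E1.
specialize (B0 t z Hin Ht E0 E1). specialize (B1 t z Hin Ht E0 E1). specialize (BL t z Hin).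
set (m := (S n - S (S k))%nat).
replace (S n - S k)%nat with (S m) in B1 by (unfold m; lia).
replace (S n - k)%nat with (S (S m)) in B0, BL by (unfold m; lia).
assert (E : ((t - t0) * (RtoC 2 * u (S (S k)) t z) = euler_defect t0 z0 n u k t z
  + (RtoC (INR n - INR k) * u k t z + - ((z - z0) * u (S k) t z)))%C).
{ unfold euler_defect. ring. }
apply (f_equal Cmod) in E. rewrite !Cmod_mult, Cmod_R, (Rabs_pos_eq 2) in E by lra.
assert (T : Cmod (t - t0) * (2 * Cmod (u (S (S k)) t z)) <= (M1 + L + INR n * M0) * rho ^ S (S m)).
{ rewrite E. eapply Rle_trans; [apply Cmod_triangle|].
  eapply Rle_trans; [apply Rplus_le_compat_l, Cmod_triangle|].
  rewrite Cmod_opp, !Cmod_mult, Cmod_R, Rabs_pos_eq.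
  2: { generalize (le_INR k n). intros HI. specialize (HI ltac:(lia)). lra. }
  assert (A1 : (INR n - INR k) * Cmod (u k t z) <= INR n * (M0 * rho ^ S (S m))).
  { apply Rmult_le_compat; [|apply Cmod_ge_0| |exact B0].
    - generalize (le_INR k n). intros HI. specialize (HI ltac:(lia)). lra.
    - generalize (pos_INR k). lra. }
  assert (A2 : Cmod (z - z0) * Cmod (u (S k) t z) <= M1 * rho ^ S (S m)).
  { replace (M1 * rho ^ S (S m)) with (rho * (M1 * rho ^ S m)) by (simpl; ring).
    apply Rmult_le_compat; try apply Cmod_ge_0; [apply Hin|exact B1]. }
  lra. }
assert (R2 : 0 < rho ^ 2) by (apply pow_lt; lra).
apply Rmult_le_reg_l with (2 * (d * rho ^ 2)); [nra|].
replace (2 * (d * rho ^ 2) * ((M1 + L + INR n * M0) / (2 * d) * rho ^ m)) with ((M1 + L + INR n * M0) * rho ^ S (S m)).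
2: { simpl; field; lra. }
eapply Rle_trans; [|exact T].
rewrite (Rmult_comm 2), Rmult_assoc. apply Rmult_le_compat_r; [|exact Ht].
generalize (Cmod_ge_0 (u (S (S k)) t z)); lra.
Qed.

(** The boundary condition says that [rho] is the parabolic distance to [(t0, z0)].
    Since [d <= 1], a boundary point with [|t - t0| < d rho^2] has [|z - z0| = rho], so
    one of the two regimes always applies. *)
Lemma no_common_zero_at_scale (u : nat -> C -> C -> C) (t0 z0 : C) (n : nat) :
  heat_chain u -> continuous_chain u -> vanishing_order u t0 z0 n ->
  at_right 0 (fun rho => forall t z, in_cylinder t0 z0 rho t z ->
    Cmod (t - t0) = rho ^ 2 \/ Cmod (z - z0) = rho ->
    u O t z = RtoC 0 -> u 1%nat t z = RtoC 0 -> False).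
Proof.
intros Hu Hc Ho. assert (Hn := proj2 Ho).
assert (HA := proj1 (Cmod_gt_0 _) Hn).
destruct (lower_bound_small_time u t0 z0 n n Hu Hc Ho (le_n n)) as [c [d [Hc0 [Hd B]]]].
destruct (upper_bound_large_time u t0 z0 n d Hu Hc Ho (proj1 Hd) n (le_n n)) as [M [HM B']].
assert (Hr : 0 < Cmod (u n t0 z0) / (4 * (M + 1))) by (apply Rdiv_lt_0_compat; lra).
generalize (filter_and _ _ (filter_and _ _ B B') (filter_and _ _ (lower_bound_top u t0 z0 n Hc Ho) (at_right_0_lt _ Hr))).
apply filter_imp. clear B B'.
intros rho [[B B'] [BT Hrho]] t z Hin Hbd E0 E1.
assert (R2 : 0 < rho ^ 2) by (apply pow_lt; lra).
destruct (Rle_lt_dec (d * rho ^ 2) (Cmod (t - t0))) as [Ht|Ht].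
- specialize (B' t z Hin Ht E0 E1). specialize (BT t z Hin).
  replace (S n - n)%nat with 1%nat in B' by lia. rewrite pow_1 in B'.
  assert (M * rho <= Cmod (u n t0 z0) / 4); [|lra].
  apply Rle_trans with ((M + 1) * (Cmod (u n t0 z0) / (4 * (M + 1)))).
  + apply Rmult_le_compat; lra.
  + right; field; lra.
- assert (Hz : Cmod (z - z0) = rho) by (destruct Hbd as [Hbd|Hbd]; [nra|exact Hbd]).
  specialize (B t z (Rlt_le _ _ Ht) Hz). rewrite Nat.sub_diag, E0, Cmod_0 in B.
  assert (0 < rho ^ n) by (apply pow_lt; lra). nra.
Qed.

Theorem theorem6 (F : C * C -> C)
    (F_nonzero : exists p : C * C, F p <> RtoC 0)
    (F_entire : entire2 F)
    (F_heat : heat_equation F)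
    (t0 z0 : C)
    (F_zero : F (t0, z0) = RtoC 0)
    (Fz_zero : partial_z F (t0, z0) = RtoC 0) :
  exists U : C * C -> Prop,
    open U /\ U (t0, z0) /\
    forall t z : C, U (t, z) -> (t, z) <> (t0, z0) ->
      (Cmod (F (t, z)) + Cmod (partial_z F (t, z)) > 0)%R.
Proof.
destruct (heat_chain_of_solution F F_entire F_heat) as [u [Hu [Hc Hu0]]].
assert (Hu1 : forall t z, u 1%nat t z = partial_z F (t, z)).
{ intros t z. apply (is_derive_C_unique (u O t) z); [apply Hu|].
  apply is_derive_ext with (fun w => F (t, w)); [intros w; symmetry; apply Hu0|now apply entire2_derive_z]. }
assert (Hex : exists n, u n t0 z0 <> RtoC 0).
{ apply Classical_Prop.NNPP. intros N. destruct F_nonzero as [[t z] Hp]. apply Hp.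
  rewrite <- Hu0. apply (heat_chain_zero u t0 z0 Hu). intros k.
  apply Classical_Prop.NNPP. intros Nk. apply N. now exists k. }
destruct (dec_inh_nat_subset_has_unique_least_element (fun n => u n t0 z0 <> RtoC 0)) as [n [[Hn Hmin] _]]; trivial.
{ intros k. apply Classical_Prop.classic. }
assert (Hlow : forall k, (k < n)%nat -> u k t0 z0 = RtoC 0).
{ intros k Hk. apply Classical_Prop.NNPP. intros Nk. specialize (Hmin k Nk). lia. }
destruct (at_right_0_elim _ (no_common_zero_at_scale u t0 z0 n Hu Hc (conj Hlow Hn))) as [r [Hr H]].
exists (fun p => Cmod (fst p - t0) < (r / 2) ^ 2 /\ Cmod (snd p - z0) < r / 2).
assert (Hr2 : 0 < (r / 2) ^ 2) by (apply pow_lt; lra).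
assert (Hball : forall (U : UniformSpace) (f : U -> C) (a : C) e, (forall p, continuous f p) ->
  open (fun p => Cmod (f p - a) < e)).
{ intros U f a e Hf p Hp.
  assert (He : 0 < e - Cmod (f p - a)) by lra.
  generalize (proj1 (continuous_C_eps f p) (Hf p) _ He). apply filter_imp.
  intros q Hq. replace (f q - a)%C with ((f q - f p) + (f p - a))%C by ring.
  eapply Rle_lt_trans; [apply Cmod_triangle|]. lra. }
split; [|split].
- apply open_and; apply (Hball (prod_UniformSpace C_UniformSpace C_UniformSpace)); intros [a b]; [apply continuous_fst|apply continuous_snd].
- simpl fst; simpl snd.
  replace (t0 - t0)%C with (RtoC 0) by ring. replace (z0 - z0)%C with (RtoC 0) by ring.
  rewrite Cmod_0. lra.
- intros t z [Ht Hz] Hne. simpl in Ht, Hz.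
  assert (Pt := Cmod_ge_0 (t - t0)). assert (Pz := Cmod_ge_0 (z - z0)).
  assert (PF := Cmod_ge_0 (F (t, z))). assert (PFz := Cmod_ge_0 (partial_z F (t, z))).
  apply Rnot_le_gt. intros Hle.
  (* The parabolic distance from [(t0, z0)] to [(t, z)]. *)
  set (rho := Rmax (sqrt (Cmod (t - t0))) (Cmod (z - z0))).
  assert (Hs := sqrt_pos (Cmod (t - t0))).
  assert (Hss := pow2_sqrt _ Pt).
  assert (H1 : sqrt (Cmod (t - t0)) <= rho) by apply Rmax_l.
  assert (H2 : Cmod (z - z0) <= rho) by apply Rmax_r.
  assert (Hrho : 0 < rho).
  { destruct (Rle_lt_dec rho 0) as [L|L]; [|exact L]. exfalso. apply Hne.
    assert (Et : Cmod (t - t0) = 0) by (rewrite <- Hss; nra).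
    assert (Ez : Cmod (z - z0) = 0) by lra.
    apply Cmod_eq_0, Ceq_minus in Et. apply Cmod_eq_0, Ceq_minus in Ez. now rewrite Et, Ez. }
  assert (Hrho2 : rho < r).
  { apply Rmax_lub_lt; [|lra]. apply Rsqr_incrst_0; [|lra|lra]. unfold Rsqr. nra. }
  apply (H rho (conj Hrho Hrho2) t z).
  + split; [rewrite <- Hss; apply pow_incr; lra|exact H2].
  + revert Hss. unfold rho, Rmax. destruct (Rle_dec (sqrt (Cmod (t - t0))) (Cmod (z - z0))); auto.
  + rewrite Hu0. apply Cmod_eq_0. lra.
  + rewrite Hu1. apply Cmod_eq_0. lra.
Qed.
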